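(* Let $\Omega_1,\dots,\Omega_m$ be mutually disjoint measurable subsets of $\hat G$ with finite and non-zero Haar measure, and let $\Omega=\bigcup_{i=1}^m\Omega_i$. Let $A\subset \mathrm{Aut}(G)$ and $\Lambda_i\subset G$ ($1\le i\le m$) be countable non-empty subsets. (1) Assume that for every $1\le i\le m$ the pair $(\Omega_i,\Lambda_i)$ is a spectral pair and that $\Omega$ tiles $\hat G$ multiplicatively by the automorphisms $A$, i.e. $\sum_{\alpha\in A}1_{\hat\alpha(\Omega)}(\xi)=1$ for a.e. $\xi\in\hat G$. Then $\{\Omega_1,\dots,\Omega_m\}$ is a wavelet collection of sets for $L^2(G)$ with respect to the dilations $A$ and the translations $\Lambda_i$ ($1\le i\le m$). (2) The converse also holds, provided that $e\in\bigcap_{i=1}^m\Lambda_i$: if $e\in\bigcap_{i=1}^m\Lambda_i$ and $\{\Omega_1,\dots,\Omega_m\}$ is a wavelet collection of sets for $L^2(G)$ with respect to the dilations $A$ and the translations $\Lambda_i$, then every pair $(\Omega_i,\Lambda_i)$ is a spectral pair and $\Omega$ tiles $\hat G$ multiplicatively by $A$.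
   Context: $(G,+)$ is an infinite, non-discrete, second countable locally compact abelian (LCA) group with identity $e$, which admits a lattice (a discrete co-compact subgroup); $\hat G$ is its dual group. $m_G$ and $m_{\hat G}$ are Haar measures on $G$ and $\hat G$, normalized so that the Fourier transform $\hat f(\xi)=\int_G f(x)\overline{\langle \xi,x\rangle}\,dm_G(x)$ extends to a unitary map $L^2(G)\to L^2(\hat G)$. $\mathrm{Aut}(G)$ is the group of topological automorphisms of $G$. The modular function $\Delta:\mathrm{Aut}(G)\to(0,\infty)$ is defined by $m_G(\alpha(E))=\Delta(\alpha)m_G(E)$ for measurable $E\subset G$; it is assumed that $\Delta$ is not identically $1$. For $\alpha\in\mathrm{Aut}(G)$ the adjoint automorphism $\hat\alpha\in \mathrm{Aut}(\hat G)$ is defined by $\langle\hat\alpha(\xi),x\rangle=\langle\xi,\alpha(x)\rangle$. For $t\in G$ write $\chi_t(\xi)=\langle\xi,t\rangle$, $\xi\in\hat G$. For measurable $E\subset\hat G$ of non-zero measure and countable $T\subset G$, $(E,T)$ is a spectral pair if the family $\{\chi_t: t\in T\}$ (restricted to $E$) is an orthogonal basis for $L^2(E)$. Given countable $A\subset\mathrm{Aut}(G)$ and countable $\Lambda_i\subset G$, the sets $\Omega_1,\dots,\Omega_m\subset\hat G$ form a wavelet collection of sets for $L^2(G)$ with respect to the dilations $A$ and translations $\Lambda_i$ if the family $\{\psi_{i,\lambda,\alpha}: 1\le i\le m,\ \lambda\in\Lambda_i,\ \alpha\in A\}$, indexed by the triples $(i,\lambda,\alpha)$, is an orthogonal basis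 for $L^2(G)$, where $\psi_{i,\lambda,\alpha}(x)=\Delta(\alpha)^{1/2}\psi_i(\alpha(x)-\lambda)$ and $\psi_i\in L^2(G)$ is given by $\hat\psi_i=1_{\Omega_i}$. *)

(* Defs.v *)
From HB Require Import structures.
From mathcomp Require Import all_boot all_order all_algebra.
From mathcomp Require Import all_classical all_reals all_analysis.
From mathcomp Require Import complex.

Set Implicit Arguments.
Unset Strict Implicit.
Unset Printing Implicit Defensive.

Import Order.TTheory GRing.Theory Num.Theory.
Import numFieldNormedType.Exports.

Local Open Scope classical_set_scope.
Local Open Scope ring_scope.
Local Open Scope complex_scope.

Notation preTopologicalZmodType := PreTopologicalZmodule.type.

Definition discrete (T : topologicalType) : Prop :=
  forall x : T, open [set x].

(* [[set` H]] carries the subspace topology and [{quot H}] is the group [G/H]. *)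
Definition lattice (G : topologicalZmodType) (H : zmodClosed G) : Prop :=
  discrete (set_type [set` H]) /\
  compact [set: quotient_topology (Quotient.quot H)].

Section Automorphisms.
Variable G : preTopologicalZmodType.

Record Aut : Type := MkAut {
  aut_fun :> G -> G ;
  autD : {morph aut_fun : x y / x + y} ;
  aut_continuous : continuous aut_fun ;
  aut_homeo : exists aut_inv : G -> G,
    [/\ cancel aut_fun aut_inv, cancel aut_inv aut_fun & continuous aut_inv]
}.

HB.instance Definition _ := gen_eqMixin Aut.
HB.instance Definition _ := gen_choiceMixin Aut.

End Automorphisms.

(* [g_sigma_algebraType] wants a pointed carrier; 0 serves as the point. *)
Definition pointed_at0 (G : preTopologicalZmodType) : Type := G.
HB.instance Definition _ (G : preTopologicalZmodType) :=
  Choice.on (pointed_at0 G).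
HB.instance Definition _ (G : preTopologicalZmodType) :=
  isPointed.Build (pointed_at0 G) (0 : G).

Notation borel G :=
  (g_sigma_algebraType (@open G : set (set (pointed_at0 G)))).

Definition radon (R : realType) (G : preTopologicalZmodType)
    (mu : {measure set (borel G) -> \bar R}) : Prop :=
  [/\ forall K : set G, compact K -> measurable (K : set (borel G)) ->
        (mu K < +oo)%E,
      forall E : set (borel G), measurable E ->
        mu E = ereal_inf [set mu U | U in [set U : set G | open U /\ E `<=` U]]
    & forall U : set G, open U ->
        mu U = ereal_sup [set mu K | K in [set K : set G |
          [/\ compact K, measurable (K : set (borel G)) & K `<=` U]]] ].

Definition haar (R : realType) (G : preTopologicalZmodType)
    (mu : {measure set (borel G) -> \bar R}) : Prop :=
  [/\ radon mu,
      (mu setT != 0)%E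
    & forall (x : G) (E : set (borel G)), measurable E ->
        mu [set x + y | y in (E : set G)] = mu E ].

(* By uniqueness of Haar measures such an r exists (and is unique) when mu is a
   Haar measure of an LCA group, so the default value 1 of [xget] is junk. *)
Definition Delta (R : realType) (G : preTopologicalZmodType)
    (mu : {measure set (borel G) -> \bar R}) (a : Aut G) : R :=
  xget 1 [set r : R | 0 < r /\
    forall E : set (borel G), measurable E -> mu (a @` E) = (r%:E * mu E)%E].

Section Dual.
Variables (R : realType) (G : topologicalZmodType).

Record dual : Type := Character {
  char_fun :> G -> R[i] ;
  char_continuous : continuous (char_fun : G -> R[i]^o) ;
  charD : forall x y, char_fun (x + y) = char_fun x * char_fun y ;
  char_norm : forall x, `|char_fun x| = 1
}.

HB.instance Definition _ := gen_eqMixin dual.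
HB.instance Definition _ := gen_choiceMixin dual.

Lemma charP (xi eta : dual) : (forall x, xi x = eta x) -> xi = eta.
Proof.
case: xi eta => [f cf Df nf] [g cg Dg ng] /= /funext fg.
by rewrite -{}fg in cg Dg ng *; congr Character; exact: Prop_irrelevance.
Qed.

Fact dual0_continuous : continuous ((fun=> 1) : G -> R[i]^o).
Proof. by move=> x; exact: cvg_cst. Qed.

Fact dual0D (x y : G) : 1 = 1 * 1 :> R[i].
Proof. by rewrite mulr1. Qed.

Fact dual0_norm (x : G) : `|1| = 1 :> R[i].
Proof. exact: normr1. Qed.

Definition dual0 : dual := @Character _ dual0_continuous dual0D dual0_norm.

Fact dualM_continuous (xi eta : dual) :
  continuous ((fun x => xi x * eta x) : G -> R[i]^o).
Proof.
move=> x; apply: (@cvgM R[i] G (nbhs x) _ (xi : G -> R[i]^o) (eta : G -> R[i]^o)).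
  exact: (@char_continuous xi x).
exact: (@char_continuous eta x).
Qed.

Fact dualM_D (xi eta : dual) (x y : G) :
  xi (x + y) * eta (x + y) = (xi x * eta x) * (xi y * eta y).
Proof. by rewrite !charD mulrACA. Qed.

Fact dualM_norm (xi eta : dual) (x : G) : `|xi x * eta x| = 1.
Proof. by rewrite normrM !char_norm mulr1. Qed.

Definition dualM (xi eta : dual) : dual :=
  @Character _ (@dualM_continuous xi eta) (dualM_D xi eta) (dualM_norm xi eta).

Fact char_neq0 (xi : dual) (x : G) : xi x != 0.
Proof. by rewrite -normr_eq0 char_norm oner_eq0. Qed.

Fact dualV_continuous (xi : dual) :
  continuous ((fun x => (xi x)^-1) : G -> R[i]^o).
Proof.
move=> x; apply: (@cvgV R[i] G (nbhs x) _ (xi : G -> R[i]^o)).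
  exact: char_neq0.
exact: (@char_continuous xi x).
Qed.

Fact dualV_D (xi : dual) (x y : G) : (xi (x + y))^-1 = (xi x)^-1 * (xi y)^-1.
Proof. by rewrite charD invfM. Qed.

Fact dualV_norm (xi : dual) (x : G) : `|(xi x)^-1| = 1.
Proof. by rewrite normfV char_norm invr1. Qed.

Definition dualV (xi : dual) : dual :=
  @Character _ (@dualV_continuous xi) (dualV_D xi) (dualV_norm xi).

Fact dualMA : associative dualM.
Proof. by move=> a b c; apply: charP => x /=; rewrite mulrA. Qed.

Fact dualMC : commutative dualM.
Proof. by move=> a b; apply: charP => x /=; rewrite mulrC. Qed.

Fact dual0M : left_id dual0 dualM.
Proof. by move=> a; apply: charP => x /=; rewrite mul1r. Qed.

Fact dualVM : left_inverse dual0 dualV dualM.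
Proof. by move=> a; apply: charP => x /=; rewrite mulVf ?char_neq0. Qed.

(* The group of characters is written additively. *)
HB.instance Definition _ :=
  GRing.isZmodule.Build dual dualMA dualMC dual0M dualVM.

HB.instance Definition _ := Topological.copy dual
  (initial_topology (char_fun : dual -> {compact-open, G -> R[i]^o})).

Fact adjoint_continuous (a : Aut G) (xi : dual) :
  continuous ((xi \o a) : G -> R[i]^o).
Proof.
move=> x; apply: (@continuous_comp G G R[i]^o a (xi : G -> R[i]^o)).
  exact: (@aut_continuous _ a).
exact: (@char_continuous xi).
Qed.

Fact adjointD (a : Aut G) (xi : dual) (x y : G) :
  (xi \o a) (x + y) = (xi \o a) x * (xi \o a) y.
Proof. by rewrite /= autD charD. Qed.

Fact adjoint_norm (a : Aut G) (xi : dual) (x : G) : `|(xi \o a) x| = 1.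
Proof. exact: char_norm. Qed.

Definition adjoint (a : Aut G) (xi : dual) : dual :=
  @Character _ (@adjoint_continuous a xi) (adjointD a xi) (adjoint_norm a xi).

Definition chi (t : G) : dual -> R[i] := fun xi => xi t.

End Dual.

(* Elements of L^p(D) are represented by functions on the whole space, which
   only matter on D; classes modulo equality a.e. are handled explicitly. *)
Section ComplexL2.
Context {R : realType} {d : measure_display} {T : measurableType d}.
Variable mu : {measure set T -> \bar R}.
Implicit Types (D : set T) (f g : T -> R[i]).

Definition cmeasurable_fun D f : Prop :=
  measurable_fun D (fun x => complex.Re (f x)) /\
  measurable_fun D (fun x => complex.Im (f x)).

Definition cintegral D f : R[i] :=
  (\int[mu]_(x in D) complex.Re (f x)) +i* (\int[mu]_(x in D) complex.Im (f x)).

Definition sqnorm D f : \bar R :=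
  (\int[mu]_(x in D) ((complex.Re `|f x|) ^+ 2)%:E)%E.

Definition L1 D f : Prop := cmeasurable_fun D f /\
  (\int[mu]_(x in D) (complex.Re `|f x|)%:E < +oo)%E.

Definition L2 D f : Prop := cmeasurable_fun D f /\ (sqnorm D f < +oo)%E.

Definition inner D f g : R[i] := cintegral D (fun x => f x * (g x)^*).

Definition orthogonal_basis D (I : Type) (J : set I) (e : I -> T -> R[i]) :
    Prop :=
  [/\ forall j, J j -> L2 D (e j) /\ sqnorm D (e j) != 0%E,
      forall j k, J j -> J k -> j <> k -> inner D (e j) (e k) = 0
    & forall f, L2 D f -> forall eps : R, 0 < eps ->
        exists (n : nat) (j : 'I_n -> I) (c : 'I_n -> R[i]),
          (forall k, J (j k)) /\
          (sqnorm D (fun x => f x - \sum_(k < n) c k * e (j k) x)%R < eps%:E)%E ].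

End ComplexL2.

Section Fourier.
Variables (R : realType) (G : topologicalZmodType).
Variables (mu : {measure set (borel G) -> \bar R}).
Variables (nu : {measure set (borel (dual R G)) -> \bar R}).

Definition fourier (f : G -> R[i]) (xi : dual R G) : R[i] :=
  cintegral mu setT (fun x => f x * (xi x)^*).

Definition fourier_extends_unitarily
    (F : (G -> R[i]) -> (dual R G -> R[i])) : Prop :=
  [/\ forall f, L2 mu setT f -> L2 nu setT (F f),
      forall (c : R[i]) f g, L2 mu setT f -> L2 mu setT g ->
        {ae nu, forall xi, F (fun x => c * f x + g x) xi = c * F f xi + F g xi},
      forall f g, L2 mu setT f -> L2 mu setT g ->
        inner nu setT (F f) (F g) = inner mu setT f g,
      forall g, L2 nu setT g -> exists2 f, L2 mu setT f &
        {ae nu, forall xi, F f xi = g xi}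
    & forall f, L1 mu setT f -> L2 mu setT f ->
        {ae nu, forall xi, F f xi = fourier f xi} ].

Definition spectral_pair (E : set (dual R G)) (S : set G) : Prop :=
  [/\ measurable (E : set (borel (dual R G))), nu E != 0%E, countable S
    & orthogonal_basis nu E S (@chi R G)].

Definition tiles_multiplicatively (W : set (dual R G)) (A : set (Aut G)) :
    Prop :=
  {ae nu, forall xi : dual R G,
    (\esum_(a in A) (\1_(@adjoint R G a @` W) xi : R)%:E = 1)%E}.

Definition wavelet_system (m : nat) (psi : 'I_m -> G -> R[i])
    (i_l_a : 'I_m * G * Aut G) : G -> R[i] :=
  let: (i, l, a) := i_l_a in
  fun x => (Num.sqrt (Delta mu a))%:C * psi i (a x - l).

(* F is the L^2 Fourier transform, so F (psi i) = 1_(W i) determines psi i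
   up to a null set. *)
Definition wavelet_collection (F : (G -> R[i]) -> (dual R G -> R[i])) (m : nat)
    (W : 'I_m -> set (dual R G)) (A : set (Aut G)) (L : 'I_m -> set G) : Prop :=
  exists psi : 'I_m -> G -> R[i],
    (forall i, L2 mu setT (psi i) /\
       {ae nu, forall xi, F (psi i) xi = (\1_(W i) xi)%:C}) /\
    orthogonal_basis mu setT
      [set j : 'I_m * G * Aut G | L j.1.1 j.1.2 /\ A j.2] (wavelet_system psi).

End Fourier.

(* Main.v *)
Require Import Defs.
From HB Require Import structures.
From mathcomp Require Import all_boot all_order all_algebra.
From mathcomp Require Import all_classical all_reals all_analysis.
From mathcomp Require Import complex.
From mathcomp Require Import measurable_realfun ring lra.

(** Why the theorem is true. Let a be an automorphism of G with inverse b, and let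
    beta be the adjoint of b, a homeomorphism of the dual. Substituting in the
    Fourier integral, the transform of x |-> psi_i (a x - l) is, up to a positive
    factor that depends on a alone, the function

      xi |-> conjugate (chi_l (beta xi)) * 1_(W_i) (beta xi)

    ([fourier_affine]). It lives on the tile of (i, a), the preimage of W_i under
    beta, that is, the image of W_i under the adjoint of a. Since the Fourier
    transform is unitary, the wavelet system is an orthogonal basis if and only if
    these functions are one ([fourier_orthogonal_basis]), and the theorem becomes a
    statement about functions supported on tiles.

    If the characters in Lambda_i form a basis of L^2(W_i), then by transport the
    functions living on one tile form a basis of L^2 of that tile; when the tiles
    partition the dual up to null sets, all of them together form a basis of L^2 of
    the dual ([tile_system_basis]). Conversely, the label l = 0 contributes multiples
    of the indicators of the tiles. Orthogonality of these makes the tiles almost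
    disjoint, and completeness of the system leaves no room outside their union
    ([basis_tiles]). Restricting to a single tile then recovers the spectral
    property of W_i ([basis_spectral]).

    The transport needs automorphisms of G, and their adjoints, to rescale Haar
    measure. This is [automorphism_scales], a consequence of the proportionality of
    invariant measures on a second countable abelian group, which is a short
    application of Tonelli's theorem ([invariant_measures_proportional]). It applies
    to the dual because the dual is second countable ([dual_second_countable]) and,
    by outer regularity, has open sets of finite measure. *)

Set Implicit Arguments.
Unset Strict Implicit.
Unset Printing Implicit Defensive.

Import Order.TTheory GRing.Theory Num.Theory.
Import numFieldNormedType.Exports.

Local Open Scope classical_set_scope.
Local Open Scope ring_scope.

(** * Borel sets of second countable groups *)

Lemma countable_basis_seq (X : topologicalType) : @second_countable X ->
  exists2 V : nat -> set X, forall n, open (V n) &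
    forall x U, nbhs x U -> exists2 n, V n x & V n `<=` U.
Proof.
move=> [B /countable_injP[f finj] [Bop Bb]].
(* The n-th set is the basis element with code n, or empty if there is none. *)
exists (fun n => \bigcup_(b in [set b | B b /\ f b = n]) b).
  by move=> n; apply: bigcup_open => b [/Bop].
move=> x U /Bb[b [Bb1 bx] bU]; exists (f b); first by exists b.
move=> y [c [Bc fcb] cy]; apply: bU; suff -> : b = c by [].
by apply: finj => //; rewrite inE.
Qed.

Section BorelGroup.
Variable X : preTopologicalZmodType.

Lemma borel_open (U : set X) : open U -> measurable (U : set (borel X)).
Proof. by move=> oU; apply: sub_sigma_algebra. Qed.

Lemma borel_closed (U : set X) : closed U -> measurable (U : set (borel X)).
Proof.
move=> cU; rewrite -[U]setCK; apply: (@measurableC _ (borel X)).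
by apply: borel_open; exact: closed_openC.
Qed.

Lemma continuous_borel_measurable (Y : preTopologicalZmodType) (f : X -> Y) :
  continuous f -> measurable_fun setT (f : borel X -> borel Y).
Proof.
move=> /continuousP fC; apply: (measurability (@open Y : set (set (borel Y))) erefl).
by move=> _ [U oU <-]; rewrite setTI; apply: borel_open; exact: fC.
Qed.

Lemma continuous_borel_preimage (Y : preTopologicalZmodType) (f : X -> Y)
    (E : set Y) : continuous f -> measurable (E : set (borel Y)) ->
  measurable (f @^-1` E : set (borel X)).
Proof.
move=> fC mE; rewrite -[X in measurable X]setTI.
exact: (continuous_borel_measurable fC).
Qed.

Lemma continuous_real_measurable (R : realType) (f : X -> R) :
  continuous f -> measurable_fun setT (f : borel X -> R).
Proof.
move=> /continuousP fC; apply: (measurability _ (measurable_realfun.RGenOpens.measurableE R)).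
move=> _ [_ [a [b ->]] <-]; rewrite setTI; apply: borel_open; apply: fC.
exact: interval_open.
Qed.

Hypothesis X_second_countable : @second_countable X.
Hypothesis sub_continuous : continuous (fun z : X * X => z.1 - z.2).

Lemma continuous_sub (Z : topologicalType) (f g : Z -> X) :
  continuous f -> continuous g -> continuous (fun z => f z - g z).
Proof.
move=> fC gC z; have fgC : {for z, continuous (fun z => (f z, g z) : X * X)}.
  by apply: cvg_pair; [exact: fC|exact: gC].
exact: (continuous_comp fgC (@sub_continuous _)).
Qed.

Lemma continuous_opp : continuous (fun x : X => - x).
Proof.
rewrite (_ : (fun x : X => - x) = (fun x => 0 - x)); last first.
  by apply/funext => x; rewrite sub0r.
by apply: continuous_sub => x; [exact: cvg_cst|exact: cvg_id].
Qed.

Lemma continuous_subr (t : X) : continuous (fun x : X => x - t).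
Proof. by apply: continuous_sub => x; [exact: cvg_id|exact: cvg_cst]. Qed.

Lemma continuous_add : continuous (fun z : X * X => z.1 + z.2).
Proof.
rewrite (_ : (fun z : X * X => z.1 + z.2) = (fun z => z.1 - - z.2)); last first.
  by apply/funext => z; rewrite opprK.
apply: continuous_sub => z; first exact: cvg_fst.
exact: (continuous_comp (@cvg_snd _ _ _ _ _) (@continuous_opp _)).
Qed.

(** An open subset of the square is a countable union of basic rectangles, so
    the topological square carries the product of the Borel structures. *)
Lemma open_square_measurable (O : set (X * X)) : open O ->
  measurable (O : set (borel X * borel X)).
Proof.
move=> oO; have [V Vop Vb] := countable_basis_seq X_second_countable.
pose S n m : set (borel X * borel X) :=
  if pselect (V n `*` V m `<=` O) then V n `*` V m else set0.
have -> : O = \bigcup_n \bigcup_m S n m.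
  apply/seteqP; split=> [[x y] Oxy|[x y] [n _ [m _]]]; last first.
    by rewrite /S; case: pselect => // h /h.
  have [[P Q]/= [/Vb[n Vnx VnP] /Vb[m Vmy VmQ]] PQO] := open_nbhs_nbhs (conj oO Oxy).
  exists n => //; exists m => //; rewrite /S; case: pselect => // -[].
  by move=> [u v]/= [/VnP Pu /VmQ Qv]; apply: PQO.
apply: bigcupT_measurable => n; apply: bigcupT_measurable => m.
rewrite /S; case: pselect => /= VO; last exact: measurable0.
by apply: measurableX; apply: borel_open; exact: Vop.
Qed.

Lemma continuous2_measurable (f : X * X -> X) : continuous f ->
  measurable_fun setT (f : borel X * borel X -> borel X).
Proof.
move=> /continuousP fC; apply: (measurability (@open X : set (set (borel X))) erefl).
by move=> _ [U oU <-]; rewrite setTI; apply: open_square_measurable; exact: fC.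
Qed.

(** The set of all t with x - t in U is open and nonempty, so it meets every
    dense sequence. *)
Lemma translates_cover (U : set X) : open U -> U !=set0 ->
  exists t : nat -> X, \bigcup_n ((fun x => x - t n) @^-1` U) = setT.
Proof.
move=> oU [u Uu]; have [V Vop Vb] := countable_basis_seq X_second_countable.
(* One point of each basis element; 0 stands in for the empty ones. *)
exists (fun n => xget 0 (V n)); apply/seteqP; split=> // x _.
have : nbhs (x - u) ((fun y => x - y) @^-1` U).
  apply: open_nbhs_nbhs; split; last by rewrite /= opprB addrCA subrr addr0.
  apply: open_comp => // y _; apply: continuous_sub => z; [exact: cvg_cst|exact: cvg_id].
by move=> /Vb[n Vnx VnU]; exists n => //=; apply: VnU; exact: (xgetI 0 Vnx).
Qed.

End BorelGroup.

(** * Invariant measures *)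

Definition translation_invariant (R : realType) (X : preTopologicalZmodType)
    (mu : set (borel X) -> \bar R) : Prop :=
  forall (t : X) (E : set (borel X)), measurable E ->
    mu ((fun x => x - t) @^-1` E) = mu E.

Lemma haar_invariant (R : realType) (X : preTopologicalZmodType)
    (mu : {measure set (borel X) -> \bar R}) :
  haar mu -> translation_invariant mu.
Proof.
move=> [_ _ inv] t E mE; rewrite -(inv t E mE); congr (mu _).
apply/seteqP; split=> x /=; first by move=> Ex; exists (x - t) => //; rewrite subrKC.
by move=> [y Ey <-]; rewrite addrC addKr.
Qed.

(** Product measures take sigma-finiteness from the type of a measure; this
    alias attaches a proof of it to a given measure. *)
Section SigmaFiniteCopy.
Context d (T : measurableType d) (R : realType).
Variables (mu : {measure set T -> \bar R}) (smu : sigma_finite setT mu).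

Definition sigma_finite_copy : set T -> \bar R := let _ := smu in mu.

HB.instance Definition _ := Measure.on sigma_finite_copy.
HB.instance Definition _ :=
  Measure_isSigmaFinite.Build d T R sigma_finite_copy smu.

End SigmaFiniteCopy.

Section Uniqueness.
Variables (R : realType) (X : preTopologicalZmodType).
Hypothesis X_second_countable : @second_countable X.
Hypothesis sub_continuous : continuous (fun z : X * X => z.1 - z.2).
Local Open Scope ereal_scope.

Lemma invariant_sigma_finite (mu : {measure set (borel X) -> \bar R}) (U : set X) :
  translation_invariant mu -> open U -> U !=set0 -> mu U < +oo ->
  sigma_finite setT mu.
Proof.
move=> inv oU U0 Uoo.
have [t tT] := translates_cover X_second_countable sub_continuous oU U0.
exists (fun n => (fun x => x - t n)%R @^-1` U) => // n.
split; last by rewrite inv //; exact: borel_open.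
apply: continuous_borel_preimage; [exact: continuous_subr|exact: borel_open].
Qed.

Lemma invariant_open_gt0 (mu : {measure set (borel X) -> \bar R}) (U : set X) :
  translation_invariant mu -> mu setT != 0 -> open U -> U !=set0 -> 0 < mu U.
Proof.
move=> inv muT oU U0; rewrite lt0e measure_ge0 andbT; apply: contra muT => /eqP U00.
have [t tT] := translates_cover X_second_countable sub_continuous oU U0.
rewrite -measure_le0 -tT.
have mt n : measurable ((fun x => x - t n)%R @^-1` U : set (borel X)).
  by apply: continuous_borel_preimage; [exact: continuous_subr|exact: borel_open].
apply: (le_trans (measure_sigma_subadditive mu mt _ (@subset_refl _ _))).
  by rewrite tT; exact: (@measurableT _ (borel X)).
by rewrite eseries0 // => n _ _; rewrite inv//; exact: borel_open.
Qed.

(** Proportionality of invariant measures, by Tonelli's theorem. Let S be the set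
    of (x, y) with y in B and x + y in E, and let S' be its image under the shear
    (x, y) -> (x, x + y). The sections of S and S' over x are translates of each
    other, so S and S' have the same measure for the product of mu and nu.
    Integrating sections over y instead, invariance of mu evaluates the measure
    of S to mu E * nu B and that of S' to nu E * mu (- B). *)
Lemma invariant_measures_proportional
    (mu nu : {sigma_finite_measure set (borel X) -> \bar R}) (E B : set (borel X)) :
  translation_invariant mu -> translation_invariant nu ->
  measurable E -> measurable B ->
  mu E * nu B = nu E * mu (-%R @^-1` B).
Proof.
move=> imu inu mE mB.
have mopp : measurable (-%R @^-1` B : set (borel X)).
  by apply: continuous_borel_preimage => //; exact: continuous_opp.
pose S := [set z : borel X * borel X | B z.2 /\ E (z.1 + z.2)%R].
pose S' := [set z : borel X * borel X | E z.2 /\ B (z.2 - z.1)%R].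
have mS : measurable S.
  apply: measurableI; first by rewrite -[X in measurable X]setTI; exact: measurable_snd.
  rewrite -[X in measurable X]setTI; apply: continuous2_measurable => //.
  exact: continuous_add.
have mS' : measurable S'.
  apply: measurableI; first by rewrite -[X in measurable X]setTI; exact: measurable_snd.
  rewrite -[X in measurable X]setTI.
  have subC : continuous (fun z : X * X => z.2 - z.1)%R.
    by apply: continuous_sub => // z; [exact: cvg_snd|exact: cvg_fst].
  exact: (continuous2_measurable X_second_countable subC measurableT mB).
have := indic_fubini_tonelli mu nu mS.
have := indic_fubini_tonelli mu nu mS'.
rewrite !indic_fubini_tonelli_FE // !indic_fubini_tonelli_GE // => h' h.
have e1 : \int[nu]_y (mu \o ysection S) y = mu E * nu B.
  rewrite (eq_integral (fun y => (\1_B y)%:E * mu E)); last first.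
    move=> y _ /=; rewrite indicE; case: (boolP (y \in B)) => yB.
      rewrite mul1e -(imu (- y)%R E) //; congr (mu _).
      apply/seteqP; split => x; rewrite /ysection /= ?inE /S /= ?opprK; first by case.
      by split=> //; rewrite -inE.
    rewrite mul0e (_ : ysection S y = set0) ?measure0//.
    apply/seteqP; split => x //; rewrite /ysection /= ?inE => -[/=].
    by rewrite notin_setE in yB.
  rewrite ge0_integralZr//; last by apply/measurable_EFinP.
  by rewrite integral_indic// setIT muleC.
have e2 : \int[nu]_y (mu \o ysection S') y = nu E * mu (-%R @^-1` B).
  rewrite (eq_integral (fun y => (\1_E y)%:E * mu (-%R @^-1` B))); last first.
    move=> y _ /=; rewrite indicE; case: (boolP (y \in E)) => yE.
      rewrite mul1e -(imu y (-%R @^-1` B)) //; congr (mu _).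
      apply/seteqP; split => x; rewrite /ysection /= ?inE /S' /= ?opprB; first by case.
      by split=> //; rewrite -inE.
    rewrite mul0e (_ : ysection S' y = set0) ?measure0//.
    apply/seteqP; split => x //; rewrite /ysection /= ?inE => -[/=].
    by rewrite notin_setE in yE.
  rewrite ge0_integralZr//; last by apply/measurable_EFinP.
  by rewrite integral_indic// setIT.
rewrite -e1 -e2 -h -h'; apply: eq_integral => x _ /=.
rewrite -(inu x); last exact: measurable_xsection.
congr (nu _); apply/seteqP; split => y; rewrite /xsection /= !inE /S /S' /= subrKC;
  by case.
Qed.

(** The pushforward of an invariant measure under an automorphism is again
    invariant, hence proportional to it. *)
Lemma automorphism_scales (mu : {measure set (borel X) -> \bar R}) (U : set X)
    (a b : X -> X) :
  translation_invariant mu -> mu setT != 0 ->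
  open U -> U !=set0 -> mu U < +oo ->
  (forall x y, b (x - y) = b x - b y)%R ->
  continuous a -> continuous b -> cancel a b -> cancel b a ->
  exists2 r : R, (0 < r)%R &
    forall E : set (borel X), measurable E -> mu (b @^-1` E) = r%:E * mu E.
Proof.
move=> inv muT oU [u Uu] Uoo bB aC bC ab ba.
have mb : measurable_fun setT (b : borel X -> borel X).
  exact: continuous_borel_measurable.
pose nu : {measure set (borel X) -> \bar R} :=
  measure_function_pushforward__canonical__measure_function_Measure mu mb.
have nuE E : nu E = mu (b @^-1` E) by [].
have inu : translation_invariant nu.
  move=> t E mE; rewrite !nuE -[in RHS](inv (a t)); last first.
    exact: (@continuous_borel_preimage X X).
  congr (mu _); apply/seteqP; split=> x /=; rewrite bB ab //.
pose V := (fun x => x + u)%R @^-1` U.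
have V0 : V 0%R by rewrite /V /= add0r.
have addC (t : X) : continuous (fun x : X => x + t)%R.
  by move=> x; rewrite -[t]opprK; exact: continuous_subr.
have oV : open V by apply: open_comp => // x _; exact: addC.
have mV : measurable (V : set (borel X)) by exact: borel_open.
have Voo : mu V < +oo.
  suff -> : mu V = mu U by [].
  rewrite -(inv (- u)%R U); last exact: borel_open.
  by congr (mu _); apply/seteqP; split=> x /=; rewrite opprK.
have oppC := @continuous_opp _ sub_continuous.
(* The test set B must be open around 0 and have finite measure both for mu and,
   after reflection, for nu. *)
pose B := V `&` (fun x => - a x)%R @^-1` V.
have a0 : a 0%R = 0%R.
  by apply: (can_inj ba); rewrite ab -[in RHS](subrr (a 0%R)) bB subrr.
have oB : open B.
  apply: openI => //; apply: open_comp => // x _.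
  exact: (continuous_comp (aC x) (@oppC _)).
have mB : measurable (B : set (borel X)) by exact: borel_open.
have B0 : B !=set0 by exists 0%R; split => //=; rewrite /= a0 oppr0.
have Bgt0 : 0 < mu B by exact: invariant_open_gt0.
have Boo : mu B < +oo.
  by apply: le_lt_trans Voo; apply: le_measure; rewrite ?inE //; exact: subIsetl.
pose smu : {sigma_finite_measure set (borel X) -> \bar R} :=
  sigma_finite_copy (invariant_sigma_finite inv oU (ex_intro _ u Uu) Uoo).
have snuT : sigma_finite setT nu.
  apply: (@invariant_sigma_finite nu (a @^-1` V)) => //.
  - by apply: open_comp => // x _; exact: aC.
  - by exists 0%R; rewrite /= a0.
  - rewrite nuE (_ : b @^-1` _ = V) //.
    by apply/seteqP; split=> x /=; rewrite ba.
pose snu : {sigma_finite_measure set (borel X) -> \bar R} := sigma_finite_copy snuT.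
have key E : measurable E -> nu E * mu B = mu E * nu (-%R @^-1` B).
  by move=> mE; exact: (@invariant_measures_proportional snu smu).
have nBoo : nu (-%R @^-1` B) < +oo.
  rewrite nuE; apply: le_lt_trans Voo; apply: le_measure; rewrite ?inE //.
  - apply: (@continuous_borel_preimage X X) => //.
    by apply: (@continuous_borel_preimage X X).
  - move=> x /= [_] /=.
    have aN y : a (- y)%R = (- a y)%R.
      by apply: (can_inj ba); rewrite ab -[(- a y)%R]sub0r -[X in (X - _)%R]a0 bB !ab sub0r.
    by rewrite aN ba opprK.
have muBfin : mu B \is a fin_num by rewrite ge0_fin_numE // ltW.
have nuBfin : nu (-%R @^-1` B) \is a fin_num by rewrite ge0_fin_numE.
have scale (E : set (borel X)) : measurable E ->
    mu (b @^-1` E) = (fine (nu (-%R @^-1` B)) / fine (mu B))%:E * mu E.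
  move=> mE; rewrite -nuE; have := key E mE.
  rewrite -(fineK muBfin) -(fineK nuBfin) /= => kE.
  have mB0 : fine (mu B) != 0%R by rewrite gt_eqF // fine_gt0 // Bgt0.
  rewrite mulrC EFinM -muleA (muleC _ (mu E)) -kE muleCA -EFinM mulVf //.
  by rewrite mule1.
exists (fine (nu (-%R @^-1` B)) / fine (mu B))%R => //.
apply: divr_gt0; last by rewrite fine_gt0 // Bgt0.
rewrite fine_gt0 // nBoo andbT lt0e measure_ge0 andbT.
apply: contra muT => /eqP nB0; have := scale setT measurableT.
by rewrite nB0 /= mul0r mul0e preimage_setT => ->.
Qed.

End Uniqueness.

(** * Topology of the dual group *)

Section DualTopology.
Variables (R : realType) (G : topologicalZmodType).
Local Notation C := (R[i]^o).

Lemma char_fun_continuous :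
  continuous (@char_fun R G : dual R G -> {compact-open, G -> C}).
Proof. exact: (@initial_continuous (dual R G) {compact-open, G -> C} (@char_fun R G)). Qed.

(** For a continuous limit, compact-open convergence is uniform convergence on
    compact sets. All continuity arguments on the dual use this description. *)
Lemma dual_cvgP (F : set_system (dual R G)) (FF : Filter F) (xi : dual R G) :
  F --> xi <-> forall K : set G, compact K -> forall e : R[i], 0 < e ->
    F [set eta : dual R G | forall x, K x -> `|xi x - eta x| < e].
Proof.
have xiC : continuous (xi : G -> C) by exact: char_continuous.
have Fco : {compact-open, ((@char_fun R G : dual R G -> G -> C) @ F) --> (xi : G -> C)} <->
   {family compact, ((@char_fun R G : dual R G -> G -> C) @ F) --> (xi : G -> C)}.
  exact: compact_open_fam_compactP.
split=> [Fxi K cK e e0|H].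
  have : {compact-open, ((@char_fun R G : dual R G -> G -> C) @ F) --> (xi : G -> C)}.
    by move=> A nA; apply: Fxi; exact: (@char_fun_continuous xi A nA).
  move=> /Fco/fam_cvgP/(_ K cK) FK.
  have /FK : nbhs ((xi : G -> C) : {uniform` K -> C})
     [set h : G -> C | forall x, K x -> `|xi x - h x| < e].
    apply/uniform_nbhs; exists [set z : C * C | `|z.1 - z.2| < e]; split.
      by rewrite -entourage_ballE; exists e.
    by [].
  by [].
have : {compact-open, ((@char_fun R G : dual R G -> G -> C) @ F) --> (xi : G -> C)}.
  apply/Fco/fam_cvgP => K cK P /uniform_nbhs[E [entE EP]].
  move: entE; rewrite -entourage_ballE => -[e /= e0 eE].
  apply: filterS (H K cK e e0) => eta Heta; apply: EP => x Kx.
  by apply: eE => /=; exact: Heta.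
move=> FC A /= [_ [[B Bop <-] Bfs sBfA]].
have FB : F (char_fun (G:=G) (R:=R) @^-1` B).
  by apply: FC; rewrite nbhsE; exists B.
exact: (filterS sBfA FB).
Qed.

Lemma dual_nbhs_compact (xi : dual R G) (K : set G) (e : R[i]) :
  compact K -> 0 < e ->
  nbhs xi [set eta : dual R G | forall x, K x -> `|xi x - eta x| < e].
Proof. by move=> cK e0; move: K cK e e0; apply/(dual_cvgP _ xi). Qed.

(** As all values have modulus one, the distance of xi / eta to f / g is at most
    the distance of xi to f plus that of eta to g. *)
Lemma dual_sub_continuous :
  continuous (fun z : dual R G * dual R G => z.1 - z.2).
Proof.
move=> [xi eta]; apply/dual_cvgP => K cK e e0 /=.
have e20 : 0 < e / 2 by rewrite divr_gt0.
exists ([set f : dual R G | forall x, K x -> `|xi x - f x| < e / 2],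
        [set f : dual R G | forall x, K x -> `|eta x - f x| < e / 2]) => /=.
  by split; exact: dual_nbhs_compact.
move=> [f g] /= [Hf Hg] x Kx /=.
have -> : xi x * (eta x)^-1 - f x * (g x)^-1 =
    (xi x - f x) * (eta x)^-1 - f x * (eta x)^-1 * (g x)^-1 * (eta x - g x).
  by field; rewrite !char_neq0.
rewrite (splitr e); apply: (le_lt_trans (ler_normB _ _)).
by apply: ltrD; rewrite !normrM !normfV !char_norm ?invr1 ?mulr1 ?mul1r;
  [exact: Hf|exact: Hg].
Qed.

Lemma adjoint_dual_continuous (a : Aut G) :
  continuous (adjoint a : dual R G -> dual R G).
Proof.
move=> xi; apply/(dual_cvgP (fmap_filter _ (nbhs_filter xi))) => K cK e e0.
have caK : compact (a @` K).
  by apply: continuous_compact => //; apply: continuous_subspaceT; exact: aut_continuous.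
apply: filterS (dual_nbhs_compact xi caK e0) => eta H x Kx /=.
by apply: H; exists x.
Qed.

Lemma chi_continuous (t : G) : continuous (@chi R G t : dual R G -> C).
Proof.
move=> xi A /nbhs_ballP[e /= e0 eA].
apply: filterS (dual_nbhs_compact xi (@compact_set1 _ t) e0) => eta H.
by apply: eA; exact: H.
Qed.

Lemma Re_continuous : continuous (@complex.Re R : C -> R).
Proof.
move=> z A /nbhs_ballP[e /= e0 eA]; apply/nbhs_ballP; exists e%:C%C => /=.
  by rewrite ltcR.
move=> w zw; apply: eA; rewrite /ball /= -ltcR; apply: le_lt_trans zw.
by rewrite -raddfB; exact: normc_ge_Re.
Qed.

Lemma normc_ge_Im (x : R[i]) : `|complex.Im x|%:C%C <= `|x|.
Proof.
case: x => a b; rewrite normc_def /= lecR -[X in X <= _]sqrtr_sqr.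
by rewrite ler_wsqrtr // lerDr sqr_ge0.
Qed.

Lemma Im_continuous : continuous (@complex.Im R : C -> R).
Proof.
move=> z A /nbhs_ballP[e /= e0 eA]; apply/nbhs_ballP; exists e%:C%C => /=.
  by rewrite ltcR.
move=> w zw; apply: eA; rewrite /ball /= -ltcR; apply: le_lt_trans zw.
by rewrite -raddfB; exact: normc_ge_Im.
Qed.

Lemma char_near (xi : dual R G) (y : G) (c : R[i]) : 0 < c ->
  nbhs y [set y' | `|xi y - xi y'| < c].
Proof.
move=> c0; have xC : {for y, continuous (xi : G -> C)} by exact: char_continuous.
have : nbhs (xi y : C) [set z : C | `|xi y - z| < c].
  by apply/nbhs_ballP; exists c.
by move=> /xC.
Qed.

Lemma complex_rat_dense (z e : R[i]) : 0 < e ->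
  exists p q : rat, `|z - (ratr p +i* ratr q)%C| < e.
Proof.
case: e => r i; rewrite ltcE /= => /andP[/eqP -> r0].
case: z => a b.
have /rat_in_itvoo[p pa] : a - r / 2 < a + r / 2 by lra.
have /rat_in_itvoo[q qb] : b - r / 2 < b + r / 2 by lra.
exists p, q; move: pa qb; rewrite !in_itv /= => /andP[pa1 pa2] /andP[qb1 qb2].
rewrite [X in `|X|]complexE; apply: (le_lt_trans (ler_normD _ _)).
have -> : `|('i * (complex.Im (a +i* b - (ratr p +i* ratr q)))%:C)%C| =
    `|(b - ratr q)|%:C%C :> R[i].
  by rewrite normrM !normc_def /= !(expr0n, expr1n, add0r, addr0) /= sqrtr1 mul1r sqrtr_sqr.
rewrite normc_def /= expr0n addr0 sqrtr_sqr.
rewrite -rmorphD ltcR /=.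
have : `|a - ratr p| < r / 2 by rewrite ltr_norml; lra.
have : `|b - ratr q| < r / 2 by rewrite ltr_norml; lra.
lra.
Qed.

(** Subbasic compact-open sets given by countable data: a basis element with
    compact closure and a ball with rational center and radius 1 / (k + 1).
    Indices whose basis element has a non-compact closure yield the whole dual. *)
Definition dual_subbase (V : nat -> set G) (j : nat * (rat * rat) * nat) :
    set (dual R G) :=
  [set xi | compact (closure (V j.1.1)) -> forall x, closure (V j.1.1) x ->
    `|((ratr j.1.2.1 : R) +i* ratr j.1.2.2)%C - xi x| < (j.2.+1%:R)^-1].

Lemma open_dual_subbase (V : nat -> set G) j : open (dual_subbase V j).
Proof.
have [cV|ncV] := pselect (compact (closure (V j.1.1))); last first.
  rewrite (_ : dual_subbase V j = setT); first exact: openT.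
  by apply/seteqP; split=> // xi _ /ncV.
pose z : C := ((ratr j.1.2.1 : R) +i* ratr j.1.2.2)%C.
pose O : set C := [set w | `|z - w| < (j.2.+1%:R)^-1].
have oO : open O.
  rewrite (_ : O = ball z (j.2.+1%:R)^-1) //; exact: ball_open.
have := @char_fun_continuous; move/continuousP => /(_ _ (compact_open_open cV oO)).
congr open; apply/seteqP; split=> xi /= H.
  by move=> _ x Vx; apply: H; exists x.
by move=> _ [x Vx <-]; exact: H.
Qed.

(** Around each point of a compact set K, the character xi maps the closure of a
    small basis element into a small rational ball; characters that do the same
    are close to xi there. By compactness finitely many of these subbasic
    conditions make a character close to xi on all of K. *)
Lemma dual_second_countable : locally_compact [set: G] ->
  @second_countable G -> @second_countable (dual R G).
Proof.
move=> lcG /countable_basis_seq[V Vop Vb].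
exists (finI_from setT (dual_subbase V)).
  by apply: finI_from_countable; exact: countableP.
split.
  move=> _ [J _ <-]; rewrite bigcap_fset; apply: big_ind => //; first exact: openT.
    by move=> *; exact: openI.
  by move=> j _; exact: open_dual_subbase.
move=> xi; set F := filter_from _ _.
have FF : Filter F.
  apply: filter_from_filter.
    have : (\bigcup_(U in finI_from setT (dual_subbase V)) U) xi.
      by rewrite finI_from_cover.
    by move=> [U bU Uxi]; exists U.
  move=> P Q [bP Pxi] [bQ Qxi]; exists (P `&` Q) => //; split=> //.
  exact: finI_fromI.
apply/dual_cvgP => K /compact_near_coveringP cK e e0.
apply: (cK (dual R G) F (fun eta x => `|xi x - eta x| < e) FF) => x Kx.
have [k ke] : exists k : nat, (k.+1%:R)^-1 + (k.+1%:R)^-1 < e :> R[i].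
  case: e e0 => r i; rewrite ltcE /= => /andP[/eqP -> r0].
  have r20 : 0 < r / 2 by rewrite divr_gt0.
  have [k _ /(_ k (leqnn k)) /= kr] := near_infty_natSinv_lt (PosNum r20).
  exists k; have -> : (k.+1%:R)^-1 = ((k.+1%:R)^-1)%:C%C :> R[i].
    by rewrite fmorphV rmorph_nat.
  by rewrite -rmorphD ltcR (splitr r); exact: ltrD.
pose d : R[i] := (k.+1%:R)^-1.
have d0 : 0 < d by rewrite invr_gt0 ltr0n.
have d40 : 0 < d / 4 by rewrite divr_gt0.
have [P xP' [cP clP]] := lcG x I.
have xP : nbhs x P.
  by move: xP'; rewrite withinE => -[Q xQ]; rewrite !setIT => ->.
have xiC (y : G) (c : R[i]) : 0 < c -> nbhs y [set y' | `|xi y - xi y'| < c].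
  exact: char_near.
have [n Vnx VnP] := Vb x _ (filterI xP (xiC x _ d40)).
have cV : compact (closure (V n)).
  apply: subclosed_compact cP _; first exact: closed_closure.
  by move/closure_id : clP => ->; apply: closureS => y /VnP[].
have [p [q pq]] := complex_rat_dense (xi x) d40.
have Vxi y : closure (V n) y -> `|(ratr p +i* ratr q)%C - xi y| < d.
  move=> /(_ _ (xiC y _ d40))[y' [/VnP[_ /= y1] /= y2]].
  have -> : (ratr p +i* ratr q)%C - xi y =
    - (xi x - (ratr p +i* ratr q)%C) + (xi x - xi y') - (xi y - xi y') by ring.
  apply: (le_lt_trans (ler_normB _ _)).
  have -> : d = d / 4 + d / 4 + (d / 4 + d / 4) by field.
  apply: ltrD; last by apply: (lt_trans y2); rewrite ltrDl.
  by apply: (le_lt_trans (ler_normD _ _)); rewrite normrN; exact: ltrD.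
pose S := dual_subbase V (n, (p, q), k).
have Sxi : S xi by move=> _ y /Vxi.
exists (V n, S) => /=.
  split; first by apply: open_nbhs_nbhs; split.
  exists S => //; split => //.
  exact: (finI_from1 (D := setT) (dual_subbase V) (i := (n, (p, q), k))).
move=> [y eta] [/= Vy Seta]; have cVy := @subset_closure _ (V n) y Vy.
have -> : xi y - eta y = ((ratr p +i* ratr q)%C - eta y) -
    ((ratr p +i* ratr q)%C - xi y) by ring.
apply: (le_lt_trans (ler_normB _ _)); apply: lt_trans ke.
by apply: ltrD; [exact: Seta|exact: Vxi].
Qed.

End DualTopology.

(** * Square-integrable complex functions *)

Section SquaredModulus.
Variable R : rcfType.
Implicit Types z w : R[i].
Local Open Scope complex_scope.

Definition sqmod z : R := complex.Re z ^+ 2 + complex.Im z ^+ 2.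

Lemma sqmod_norm z : complex.Re `|z| ^+ 2 = sqmod z.
Proof.
by rewrite normc_def /= sqr_sqrtr // addr_ge0 // sqr_ge0.
Qed.

Lemma sqmod_ge0 z : 0 <= sqmod z.
Proof. by rewrite addr_ge0 // sqr_ge0. Qed.

Lemma sqmod0 : sqmod 0 = 0.
Proof. by rewrite /sqmod /= expr0n addr0. Qed.

Lemma sqmod1 : sqmod 1 = 1.
Proof. by rewrite /sqmod /= expr1n expr0n addr0. Qed.

Lemma sqmodM z w : sqmod (z * w) = sqmod z * sqmod w.
Proof. by case: z w => [a b] [c d]; rewrite /sqmod /=; ring. Qed.

Lemma sqmod_conj z : sqmod z^* = sqmod z.
Proof. by case: z => a b; rewrite /sqmod /= sqrrN. Qed.

Lemma sqmodN z : sqmod (- z) = sqmod z.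
Proof. by case: z => a b; rewrite /sqmod /= !sqrrN. Qed.

Lemma sqmod_real (r : R) : sqmod r%:C = r ^+ 2.
Proof. by rewrite /sqmod /= expr0n addr0. Qed.

Lemma sqmod_eq0 z : (sqmod z == 0) = (z == 0).
Proof.
case: z => a b; rewrite /sqmod /= paddr_eq0 ?sqr_ge0 // !sqrf_eq0.
by rewrite eq_complex.
Qed.

Lemma sqmod_unit z : `|z| = 1 -> sqmod z = 1.
Proof. by move=> z1; rewrite -sqmod_norm z1 /= expr1n. Qed.

(** This stands in for the triangle inequality of the mean-square norm: it lets
    squared norms be estimated without taking square roots of integrals. *)
Lemma sqmodD_le z w : sqmod (z + w) <= 2 * sqmod z + 2 * sqmod w.
Proof.
case: z w => [a b] [c d]; rewrite /sqmod /=.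
have := sqr_ge0 (a - c); have := sqr_ge0 (b - d); nra.
Qed.

Lemma mul_conjE z : z * z^* = (sqmod z)%:C.
Proof. by case: z => a b; rewrite /sqmod /=; simpc; congr (_ +i* _); ring. Qed.

Lemma norm_mul_le z w : complex.Re `|z * w| <= sqmod z + sqmod w.
Proof.
rewrite normrM -!sqmod_norm !normc_def /=.
move: (Num.sqrt _) (Num.sqrt _) => s t.
by have := sqr_ge0 (s - t); have := sqr_ge0 (s + t); nra.
Qed.

Lemma Re_le_norm z : `|complex.Re z| <= complex.Re `|z|.
Proof.
case: z => a b; rewrite normc_def /= -[X in X <= _]sqrtr_sqr ler_wsqrtr //.
by rewrite lerDl sqr_ge0.
Qed.

Lemma Im_le_norm z : `|complex.Im z| <= complex.Re `|z|.
Proof.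
case: z => a b; rewrite normc_def /= -[X in X <= _]sqrtr_sqr ler_wsqrtr //.
by rewrite lerDr sqr_ge0.
Qed.

Lemma Re_norm_ge0 z : 0 <= complex.Re `|z|.
Proof. by rewrite normc_def /= sqrtr_ge0. Qed.

End SquaredModulus.

Section ComplexMeasurable.
Context {R : realType} {d : measure_display} {T : measurableType d}.
Implicit Types (D : set T) (f g : T -> R[i]).
Local Open Scope complex_scope.

Lemma cmeas_cst D (c : R[i]) : cmeasurable_fun D (fun=> c).
Proof. by split; exact: measurable_cst. Qed.

Lemma cmeasD D f g : cmeasurable_fun D f -> cmeasurable_fun D g ->
  cmeasurable_fun D (fun x => f x + g x).
Proof.
move=> [mf1 mf2] [mg1 mg2]; split.
  by under eq_fun do rewrite raddfD; exact: measurable_funD.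
by under eq_fun do rewrite raddfD; exact: measurable_funD.
Qed.

Lemma cmeasM D f g : cmeasurable_fun D f -> cmeasurable_fun D g ->
  cmeasurable_fun D (fun x => f x * g x).
Proof.
move=> [mf1 mf2] [mg1 mg2].
have ReM (z w : R[i]) : complex.Re (z * w) =
  complex.Re z * complex.Re w - complex.Im z * complex.Im w by case: z w => [? ?] [].
have ImM (z w : R[i]) : complex.Im (z * w) =
  complex.Re z * complex.Im w + complex.Im z * complex.Re w by case: z w => [? ?] [].
split.
  by under eq_fun do rewrite ReM; apply: measurable_funB; exact: measurable_funM.
by under eq_fun do rewrite ImM; apply: measurable_funD; exact: measurable_funM.
Qed.

Lemma cmeasN D f : cmeasurable_fun D f -> cmeasurable_fun D (fun x => - f x).
Proof.
move=> mf; under eq_fun do rewrite -mulN1r.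
by apply: cmeasM => //; exact: cmeas_cst.
Qed.

Lemma cmeasB D f g : cmeasurable_fun D f -> cmeasurable_fun D g ->
  cmeasurable_fun D (fun x => f x - g x).
Proof. by move=> mf mg; apply: cmeasD => //; exact: cmeasN. Qed.

Lemma cmeas_conj D f : cmeasurable_fun D f -> cmeasurable_fun D (fun x => (f x)^*).
Proof.
have ReJ (z : R[i]) : complex.Re (z^*) = complex.Re z by case: z.
have ImJ (z : R[i]) : complex.Im (z^*) = - complex.Im z by case: z.
move=> [mf1 mf2]; split.
  by under eq_fun do rewrite ReJ.
under eq_fun do rewrite ImJ; exact: measurable_funN.
Qed.

Lemma cmeas_sub D E f : measurable E -> D `<=` E ->
  cmeasurable_fun E f -> cmeasurable_fun D f.
Proof.
by move=> mE DE [m1 m2]; split; exact: (measurable_funS mE).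
Qed.

Lemma cmeas_indic D (E : set T) : measurable E ->
  cmeasurable_fun D (fun x => ((\1_E x : R)%:C)).
Proof.
by move=> mE; split => /=; [exact: measurable_indic|exact: measurable_cst].
Qed.

Lemma cmeas_restrict D f : measurable D -> cmeasurable_fun D f ->
  cmeasurable_fun setT (fun x => f x * (\1_D x)%:C).
Proof.
move=> mD [m1 m2]; split.
  rewrite (_ : (fun x => _) = (fun x => complex.Re (f x)) \_ D).
    exact/(measurable_restrictT _ mD).1.
  apply/funext => x; rewrite patchE indicE.
  by case: ifP => _ /=; case: (f x) => a b /=; rewrite !(mulr1, mulr0, subr0).
rewrite (_ : (fun x => _) = (fun x => complex.Im (f x)) \_ D).
  exact/(measurable_restrictT _ mD).1.
apply/funext => x; rewrite patchE indicE.
by case: ifP => _ /=; case: (f x) => a b /=; rewrite !(mulr1, mulr0, addr0, add0r).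
Qed.

Lemma cmeas_sum D (n : nat) (h : 'I_n -> T -> R[i]) :
  (forall k, cmeasurable_fun D (h k)) ->
  cmeasurable_fun D (fun x => \sum_(k < n) h k x).
Proof.
elim: n h => [|n IH] h mh.
  by under eq_fun do rewrite big_ord0; exact: cmeas_cst.
under eq_fun do rewrite big_ord_recl; apply: cmeasD => //.
by apply: IH => k; exact: mh.
Qed.

Lemma measurable_sqmod D f : cmeasurable_fun D f ->
  measurable_fun D (fun x => (sqmod (f x))%:E).
Proof.
move=> [m1 m2]; apply/measurable_EFinP; apply: measurable_funD;
  by apply: measurable_funX.
Qed.

Lemma measurable_norm D f : cmeasurable_fun D f ->
  measurable_fun D (fun x => (complex.Re `|f x|)%:E).
Proof.
move=> mf; apply/measurable_EFinP.
rewrite (_ : (fun x => _) = Num.sqrt \o (fun x => sqmod (f x))).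
  apply: measurableT_comp; last by apply/measurable_EFinP; exact: measurable_sqmod.
  by apply: continuous_measurable_fun; exact: sqrt_continuous.
by apply/funext => x; rewrite normc_def.
Qed.

End ComplexMeasurable.

Lemma cmeas_comp {R : realType} {d d'} {T : measurableType d} {T' : measurableType d'}
    (tau : T -> T') (f : T' -> R[i]) : measurable_fun setT tau ->
  cmeasurable_fun setT f -> cmeasurable_fun setT (fun x => f (tau x)).
Proof.
move=> mt [m1 m2].
by split; [exact: (measurableT_comp m1 mt)|exact: (measurableT_comp m2 mt)].
Qed.

Section SquareNorm.
Context {R : realType} {d : measure_display} {T : measurableType d}.
Variable mu : {measure set T -> \bar R}.
Implicit Types (D : set T) (f g : T -> R[i]).
Local Open Scope ereal_scope.

Lemma sqnormE D f : sqnorm mu D f = \int[mu]_(x in D) (sqmod (f x))%:E.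
Proof. by rewrite /sqnorm; under eq_integral do rewrite sqmod_norm. Qed.

Lemma sqnorm_ge0 D f : 0 <= sqnorm mu D f.
Proof. by rewrite sqnormE; apply: integral_ge0 => x _; rewrite lee_fin sqmod_ge0. Qed.

Lemma sqnorm_ae_eq D f g : measurable D ->
  cmeasurable_fun D f -> cmeasurable_fun D g ->
  {ae mu, forall x, D x -> f x = g x} -> sqnorm mu D f = sqnorm mu D g.
Proof.
move=> mD mf mg fg; rewrite !sqnormE; apply: ge0_ae_eq_integral => //.
- exact: measurable_sqmod.
- exact: measurable_sqmod.
- by move=> x _; rewrite lee_fin sqmod_ge0.
- by move=> x _; rewrite lee_fin sqmod_ge0.
- by apply: filterS fg => x fg Dx; rewrite fg.
Qed.

Lemma eq_sqnorm D f g : (forall x, D x -> f x = g x) -> sqnorm mu D f = sqnorm mu D g.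
Proof.
by move=> fg; rewrite !sqnormE; apply: eq_integral => x; rewrite inE => /fg ->.
Qed.

Lemma sqnormZ D (c : R[i]) f : measurable D -> cmeasurable_fun D f ->
  sqnorm mu D (fun x => c * f x)%R = (sqmod c)%:E * sqnorm mu D f.
Proof.
move=> mD mf; rewrite !sqnormE -ge0_integralZl_EFin ?sqmod_ge0 //.
- by apply: eq_integral => x _; rewrite sqmodM EFinM.
- by move=> x _; rewrite lee_fin sqmod_ge0.
- exact: measurable_sqmod.
Qed.

Lemma sqnormD_le D f g : measurable D ->
  cmeasurable_fun D f -> cmeasurable_fun D g ->
  sqnorm mu D (fun x => f x + g x)%R <= 2%:E * sqnorm mu D f + 2%:E * sqnorm mu D g.
Proof.
move=> mD mf mg; rewrite !sqnormE -!ge0_integralZl_EFin //; try by [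
  move=> x _; rewrite lee_fin sqmod_ge0 | exact: measurable_sqmod].
rewrite -ge0_integralD //; first last.
- by apply: measurable_funeM; exact: measurable_sqmod.
- by move=> x _; rewrite lee_fin mulr_ge0 // sqmod_ge0.
- by apply: measurable_funeM; exact: measurable_sqmod.
- by move=> x _; rewrite lee_fin mulr_ge0 // sqmod_ge0.
apply: ge0_le_integral => //.
- by move=> x _; rewrite lee_fin sqmod_ge0.
- by apply: measurable_sqmod; exact: cmeasD.
- by apply: emeasurable_funD; apply: measurable_funeM; exact: measurable_sqmod.
- by move=> x _; rewrite -!EFinM -EFinD lee_fin; exact: sqmodD_le.
Qed.

Lemma sqnorm_subset D E f : measurable D -> measurable E -> D `<=` E ->
  cmeasurable_fun E f -> sqnorm mu D f <= sqnorm mu E f.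
Proof.
move=> mD mE DE mf; rewrite !sqnormE; apply: ge0_subset_integral => //.
  exact: measurable_sqmod.
by move=> x _; rewrite lee_fin sqmod_ge0.
Qed.

Lemma sqnorm_restrict D f :
  sqnorm mu setT (fun x => f x * (\1_D x)%:C%C)%R = sqnorm mu D f.
Proof.
rewrite !sqnormE [RHS]integral_mkcond; apply: eq_integral => x _.
rewrite patchE indicE; case: ifP => _; first by rewrite mulr1.
by rewrite mulr0 sqmod0.
Qed.

(** Two square-integrable functions are identified almost everywhere by bounding
    the squared norm of their difference. *)
Lemma sqnorm_eq0_ae D f : measurable D -> cmeasurable_fun D f ->
  sqnorm mu D f = 0 -> {ae mu, forall x, D x -> f x = 0%R}.
Proof.
move=> mD mf f0.
have := (ae_eq_integral_abs mu mD (measurable_sqmod mf)).1.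
have -> : \int[mu]_(x in D) `|(sqmod (f x))%:E| = 0.
  rewrite -f0 sqnormE; apply: eq_integral => x _.
  by rewrite gee0_abs // lee_fin sqmod_ge0.
move=> /(_ erefl); apply: filterS => x h Dx.
by have /eqP := h Dx; rewrite eqe sqmod_eq0 => /eqP.
Qed.

Lemma L2D D f g : measurable D -> L2 mu D f -> L2 mu D g ->
  L2 mu D (fun x => f x + g x)%R.
Proof.
move=> mD [mf f2] [mg g2]; split; first exact: cmeasD.
apply: le_lt_trans (sqnormD_le mD mf mg) _.
by rewrite lte_add_pinfty // lte_mul_pinfty.
Qed.

Lemma L2Z D (c : R[i]) f : measurable D -> L2 mu D f ->
  L2 mu D (fun x => c * f x)%R.
Proof.
move=> mD [mf f2]; split; first by apply: cmeasM => //; exact: cmeas_cst.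
by rewrite sqnormZ // lte_mul_pinfty // lee_fin sqmod_ge0.
Qed.

Lemma L2B D f g : measurable D -> L2 mu D f -> L2 mu D g ->
  L2 mu D (fun x => f x - g x)%R.
Proof.
move=> mD fL gL; apply: L2D => //.
have := L2Z (-1)%R mD gL; congr (L2 mu D _).
by apply/funext => x; rewrite mulN1r.
Qed.

Lemma L2_cst0 D : measurable D -> L2 mu D (fun=> 0%R).
Proof.
move=> mD; split; first exact: cmeas_cst.
by rewrite sqnormE integral0_eq // => x _; rewrite sqmod0.
Qed.

Lemma L2_sum D (n : nat) (h : 'I_n -> T -> R[i]) : measurable D ->
  (forall k, L2 mu D (h k)) -> L2 mu D (fun x => \sum_(k < n) h k x)%R.
Proof.
move=> mD; elim: n h => [|n IH] h mh.
  by under eq_fun do rewrite big_ord0; exact: L2_cst0.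
under eq_fun do rewrite big_ord_recl; apply: L2D => //.
by apply: IH => k; exact: mh.
Qed.

Lemma L2_restrict D f : measurable D -> L2 mu D f ->
  L2 mu setT (fun x => f x * (\1_D x)%:C%C)%R.
Proof.
by move=> mD [mf f2]; split; [exact: cmeas_restrict|rewrite sqnorm_restrict].
Qed.

Lemma L2_subset D E f : measurable D -> measurable E -> D `<=` E ->
  L2 mu E f -> L2 mu D f.
Proof.
move=> mD mE DE [mf f2]; split; first exact: cmeas_sub DE mf.
by apply: le_lt_trans f2; exact: sqnorm_subset.
Qed.

Lemma L2_ae_eq D f g : measurable D -> cmeasurable_fun D g -> L2 mu D f ->
  {ae mu, forall x, D x -> f x = g x} -> L2 mu D g.
Proof. by move=> mD mg [mf f2] fg; split => //; rewrite -(sqnorm_ae_eq mD mf mg fg). Qed.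

Lemma sqnorm_indic D (E : set T) : measurable D -> measurable E ->
  sqnorm mu D (fun x => (\1_E x)%:C%C) = mu (E `&` D).
Proof.
move=> mD mE; rewrite -integral_indic // sqnormE; apply: eq_integral => x _.
by rewrite indicE; case: (_ \in _); rewrite /= ?sqmod1 ?sqmod0.
Qed.

Lemma L2_indic (E : set T) : measurable E -> mu E < +oo ->
  L2 mu setT (fun x => (\1_E x)%:C%C).
Proof.
by move=> mE Eoo; split; [exact: cmeas_indic|rewrite sqnorm_indic // setIT].
Qed.

(** Truncations to an increasing exhaustion converge in mean square. *)
Lemma sqnorm_tail (F : nat -> set T) f (e : R) :
  (forall n, measurable (F n)) -> nondecreasing_seq F ->
  mu (~` \bigcup_n F n) = 0 -> L2 mu setT f -> (0 < e)%R ->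
  exists n, sqnorm mu (~` F n) f < e%:E.
Proof.
move=> mF ndF cF [mf f2] e0.
have mU : measurable (\bigcup_n F n) by exact: bigcupT_measurable.
have msq D : measurable_fun D (fun x => (sqmod (f x))%:E).
  by apply: (measurable_funS measurableT) => //; exact: measurable_sqmod.
have sq0 x : 0 <= (sqmod (f x))%:E by rewrite lee_fin sqmod_ge0.
have split_norm (D : set T) : measurable D ->
    sqnorm mu setT f = sqnorm mu D f + sqnorm mu (~` D) f.
  move=> mD; rewrite !sqnormE -(setUv D) ge0_integral_setU //.
  - exact: measurableC.
  - by rewrite disj_set2E setICr.
have fU : sqnorm mu setT f = sqnorm mu (\bigcup_n F n) f.
  rewrite (split_norm _ mU) [X in _ + X](_ : _ = 0) ?adde0 // sqnormE.
  transitivity (\int[mu]_(x in ~` \bigcup_n F n) `|(sqmod (f x))%:E|).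
    by apply: eq_integral => x _; rewrite gee0_abs.
  by apply: integral_abs_eq0 => //; exact: measurableC.
have : sqnorm mu (F n) f @[n --> \oo] --> sqnorm mu setT f.
  rewrite fU; under eq_fun do rewrite sqnormE; rewrite sqnormE.
  exact: ge0_nondecreasing_set_cvg_integral.
have ffin : sqnorm mu setT f \is a fin_num by rewrite ge0_fin_numE // sqnorm_ge0.
rewrite -(fineK ffin) => /fine_cvgP[_] /cvgrPdist_lt /(_ e e0)[n _ /(_ n (leqnn n))] /= ne.
exists n; have Ffin : sqnorm mu (F n) f \is a fin_num.
  rewrite ge0_fin_numE ?sqnorm_ge0 //; apply: le_lt_trans f2.
  exact: sqnorm_subset.
have cFfin : sqnorm mu (~` F n) f \is a fin_num.
  rewrite ge0_fin_numE ?sqnorm_ge0 //; apply: le_lt_trans f2.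
  by apply: sqnorm_subset => //; exact: measurableC.
move: ne; rewrite (split_norm _ (mF n)) fineD // addrAC subrr add0r.
rewrite ger0_norm ?fine_ge0 ?sqnorm_ge0 // => ne.
by rewrite -(fineK cFfin) lte_fin.
Qed.

End SquareNorm.

(** * Complex integrals *)

Section ComplexIntegral.
Context {R : realType} {d : measure_display} {T : measurableType d}.
Variable mu : {measure set T -> \bar R}.
Implicit Types (D : set T) (f g h : T -> R[i]).

Lemma L1_integrable D h : measurable D -> L1 mu D h ->
  mu.-integrable D (EFin \o (fun x => complex.Re (h x))) /\
  mu.-integrable D (EFin \o (fun x => complex.Im (h x))).
Proof.
move=> mD [[m1 m2] hoo].
have ih : mu.-integrable D (EFin \o (fun x => complex.Re `|h x|)).
  apply/integrableP; split; first exact: measurable_norm.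
  apply: le_lt_trans hoo; apply: ge0_le_integral => //.
  - by apply: measurableT_comp => //; exact: measurable_norm.
  - exact: measurable_norm.
  - by move=> x _ /=; rewrite lee_fin ger0_norm // Re_norm_ge0.
split; apply: le_integrable ih => //; try exact/measurable_EFinP.
  by move=> x _ /=; rewrite lee_fin [leRHS]ger0_norm ?Re_norm_ge0 ?Re_le_norm.
by move=> x _ /=; rewrite lee_fin [leRHS]ger0_norm ?Re_norm_ge0 ?Im_le_norm.
Qed.

Lemma L1_mul_conj D f g : measurable D -> L2 mu D f -> L2 mu D g ->
  L1 mu D (fun x => f x * ((g x)^*)%C).
Proof.
move=> mD [mf f2] [mg g2]; have mfg : cmeasurable_fun D (fun x => f x * ((g x)^*)%C).
  by apply: cmeasM => //; exact: cmeas_conj.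
split => //; apply: (@le_lt_trans _ _ (sqnorm mu D f + sqnorm mu D g)%E).
  rewrite !sqnormE -ge0_integralD //; first last.
  - exact: measurable_sqmod.
  - by move=> x _; rewrite lee_fin sqmod_ge0.
  - exact: measurable_sqmod.
  - by move=> x _; rewrite lee_fin sqmod_ge0.
  apply: ge0_le_integral => //.
  - by move=> x _; rewrite lee_fin Re_norm_ge0.
  - exact: measurable_norm.
  - by apply: emeasurable_funD; exact: measurable_sqmod.
  - move=> x _; rewrite -EFinD lee_fin; apply: le_trans (norm_mul_le _ _) _.
    by rewrite sqmod_conj.
by rewrite lte_add_pinfty.
Qed.

Lemma L1_restrict (E : set T) f : measurable E -> (mu E < +oo)%E -> L2 mu setT f ->
  L1 mu setT (fun x => f x * (\1_E x)%:C%C).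
Proof.
move=> mE Eoo fL.
have := L1_mul_conj measurableT fL (L2_indic mE Eoo); congr (L1 mu setT _).
by apply/funext => x; congr (_ * _); rewrite conjc_real.
Qed.

Lemma L1_mul_unit D f u : measurable D -> cmeasurable_fun D u ->
  (forall x, `|u x| = 1) -> L1 mu D f -> L1 mu D (fun x => f x * u x).
Proof.
move=> mD mu' u1 [mf f1]; split; first exact: cmeasM.
by under eq_integral do rewrite normrM u1 mulr1.
Qed.

Lemma eq_cintegral D f g : (forall x, D x -> f x = g x) ->
  cintegral mu D f = cintegral mu D g.
Proof.
by move=> fg; congr (_ +i* _)%C; apply: eq_Rintegral => x; rewrite inE => /fg ->.
Qed.

Lemma cintegral_ae_eq D f g : measurable D -> cmeasurable_fun D f ->
  cmeasurable_fun D g -> {ae mu, forall x, D x -> f x = g x} ->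
  cintegral mu D f = cintegral mu D g.
Proof.
move=> mD [mf1 mf2] [mg1 mg2] fg; congr (_ +i* _)%C; congr fine;
  apply: ae_eq_integral => //; try (exact/measurable_EFinP);
  by apply: filterS fg => x fg Dx; rewrite fg.
Qed.

Lemma cintegral_restrict D f :
  cintegral mu setT (fun x => f x * (\1_D x)%:C%C) = cintegral mu D f.
Proof.
congr (_ +i* _)%C; rewrite [RHS]Rintegral_mkcond; apply: eq_Rintegral => x _;
  rewrite patchE indicE; case: ifP => _ /=; case: (f x) => a b /=;
  by rewrite !(mulr1, mulr0, subr0, addr0, add0r, oppr0).
Qed.

Lemma cintegralZ D (c : R[i]) h : measurable D -> L1 mu D h ->
  cintegral mu D (fun x => c * h x) = c * cintegral mu D h.
Proof.
move=> mD hL; have [iRe iIm] := L1_integrable mD hL.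
rewrite /cintegral; case: c => a b; simpc.
have iZ (r : R) (k : T -> R) : mu.-integrable D (EFin \o k) ->
    mu.-integrable D (EFin \o (fun x => r * k x)).
  by move=> ik; exact: (integrableZl mD r ik).
congr (_ +i* _)%C.
  rewrite -!RintegralZl // -RintegralB //; try exact: iZ.
  by apply: eq_Rintegral => x _; case: (h x).
rewrite -!RintegralZl // -RintegralD //; try exact: iZ.
by apply: eq_Rintegral => x _; case: (h x).
Qed.

Lemma cintegral_conj D h : measurable D -> L1 mu D h ->
  cintegral mu D (fun x => ((h x)^*)%C) = ((cintegral mu D h)^*)%C.
Proof.
move=> mD hL; have [iRe iIm] := L1_integrable mD hL.
rewrite /cintegral /=; congr (_ +i* _)%C.
  by apply: eq_Rintegral => x _; case: (h x).
rewrite -mulN1r -RintegralZl //.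
by apply: eq_Rintegral => x _; rewrite mulN1r; case: (h x).
Qed.

Lemma cintegral0 D f : (forall x, D x -> f x = 0) -> cintegral mu D f = 0.
Proof.
move=> f0; rewrite (eq_cintegral (g := fun=> 0)) // /cintegral /=.
by rewrite /Rintegral integral0.
Qed.

Lemma inner_self D f : L2 mu D f -> inner mu D f f = (fine (sqnorm mu D f))%:C%C.
Proof.
move=> [mf f2]; rewrite /inner /cintegral; congr (_ +i* _)%C.
  by rewrite sqnormE; congr fine; apply: eq_integral => x _; rewrite mul_conjE.
transitivity (Rintegral mu D (fun=> 0)).
  by apply: eq_Rintegral => x _; rewrite mul_conjE.
by rewrite /Rintegral integral0.
Qed.

Lemma inner_ae_eq D f f' g g' : measurable D ->
  cmeasurable_fun D f -> cmeasurable_fun D f' ->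
  cmeasurable_fun D g -> cmeasurable_fun D g' ->
  {ae mu, forall x, D x -> f x = f' x} -> {ae mu, forall x, D x -> g x = g' x} ->
  inner mu D f g = inner mu D f' g'.
Proof.
move=> mD mf mf' mg mg' ff' gg'; apply: cintegral_ae_eq => //.
- by apply: cmeasM => //; exact: cmeas_conj.
- by apply: cmeasM => //; exact: cmeas_conj.
by apply: filterS2 ff' gg' => x ff' gg' Dx; rewrite ff' // gg'.
Qed.

End ComplexIntegral.

(** * Maps that rescale measures *)

Definition scales {R : realType} {d d'} {T : measurableType d} {T' : measurableType d'}
    (mu : set T -> \bar R) (nu : set T' -> \bar R) (tau : T -> T') (k : R) : Prop :=
  [/\ measurable_fun setT tau, 0 < k &
      forall E, measurable E -> mu (tau @^-1` E) = (k%:E * nu E)%E].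

Section ChangeOfVariables.
Context {R : realType} {d d'} {T : measurableType d} {T' : measurableType d'}.
Variables (mu : {measure set T -> \bar R}) (nu : {measure set T' -> \bar R}).
Variables (tau : T -> T') (k : R).
Hypothesis sc : scales mu nu tau k.

Let mtau : measurable_fun setT tau. Proof. by case: sc. Qed.
Let k0 : 0 < k. Proof. by case: sc. Qed.

Lemma scales_preimage_measurable (E : set T') : measurable E -> measurable (tau @^-1` E).
Proof. by move=> mE; rewrite -[X in measurable X]setTI; exact: mtau. Qed.

Lemma ge0_integral_scales (D : set T') (h : T' -> \bar R) : measurable D ->
  measurable_fun D h -> (forall y, D y -> (0 <= h y)%E) ->
  (\int[mu]_(x in tau @^-1` D) h (tau x) = k%:E * \int[nu]_(y in D) h y)%E.
Proof.
move=> mD mh h0; pose kn : {nonneg R} := NngNum (ltW k0).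
have -> : (k%:E * \int[nu]_(y in D) h y = \int[mscale kn nu]_(y in D) h y)%E.
  by rewrite ge0_integral_mscale.
have := @ge0_integral_pushforward _ _ _ _ _ tau mtau mu D h mD mh.
move=> /(_ (fun y => _)) <-; last by move=> y; rewrite inE; exact: h0.
by apply: eq_measure_integral => A mA _; case: sc => _ _ /(_ A mA).
Qed.

Lemma scales_ae (P : T' -> Prop) :
  {ae nu, forall y, P y} -> {ae mu, forall x, P (tau x)}.
Proof.
move=> [N [mN N0 PN]]; exists (tau @^-1` N); split.
- exact: scales_preimage_measurable.
- by case: sc => _ _ ->//; rewrite N0 mule0.
- by move=> x /= nP; exact: PN.
Qed.

Lemma sqnorm_scales (D : set T') (f : T' -> R[i]) : measurable D ->
  cmeasurable_fun D f ->
  sqnorm mu (tau @^-1` D) (f \o tau) = (k%:E * sqnorm nu D f)%E.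
Proof.
move=> mD mf; rewrite !sqnormE.
rewrite -(ge0_integral_scales mD (measurable_sqmod mf)) // => y _.
by rewrite lee_fin sqmod_ge0.
Qed.

Lemma L2_scales (f : T' -> R[i]) : L2 nu setT f -> L2 mu setT (f \o tau).
Proof.
move=> [mf f2]; split; first exact: cmeas_comp.
rewrite -(preimage_setT tau) sqnorm_scales // lte_mul_pinfty // lee_fin; exact: ltW.
Qed.

Lemma L1_scales (f : T' -> R[i]) : L1 nu setT f -> L1 mu setT (f \o tau).
Proof.
move=> [mf f1]; split; first exact: cmeas_comp.
have := @ge0_integral_scales setT (fun y => (complex.Re `|f y|)%:E) measurableT.
rewrite preimage_setT => ->; last 2 first.
- exact: measurable_norm.
- by move=> y _; rewrite lee_fin Re_norm_ge0.
by rewrite lte_mul_pinfty // lee_fin; exact: ltW.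
Qed.

Let Rintegral_scales (h : T' -> R) : nu.-integrable setT (EFin \o h) ->
  Rintegral mu setT (h \o tau) = k * Rintegral nu setT h.
Proof.
move=> inh; have mh := measurable_int _ inh.
have e (g : T' -> \bar R) : measurable_fun setT g -> (forall y, (0 <= g y)%E) ->
    (\int[mu]_x g (tau x) = k%:E * \int[nu]_y g y)%E.
  move=> mg g0; have := @ge0_integral_scales setT g measurableT mg (fun y _ => g0 y).
  by rewrite preimage_setT.
rewrite /Rintegral.
have -> : (\int[mu]_x ((h \o tau) x)%:E = k%:E * \int[nu]_y (h y)%:E)%E.
  rewrite integralE [in RHS]integralE.
  rewrite -[X in (X - _ = _)%E]/(\int[mu]_x ((EFin \o h) \o tau)^\+ x)%E.
  rewrite -[X in (_ - X = _)%E]/(\int[mu]_x ((EFin \o h) \o tau)^\- x)%E.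
  rewrite funepos_comp funeneg_comp.
  rewrite !e //; [|exact: measurable_funeneg|exact: measurable_funepos].
  rewrite -muleBr //; apply: fin_num_adde_defr.
  exact: integrable_pos_fin_num inh.
rewrite fineM //; exact: integrable_fin_num.
Qed.

Lemma cintegral_scales (h : T' -> R[i]) : L1 nu setT h ->
  cintegral mu setT (h \o tau) = k%:C%C * cintegral nu setT h.
Proof.
move=> hL; have [iRe iIm] := L1_integrable measurableT hL.
rewrite /cintegral (Rintegral_scales iRe) (Rintegral_scales iIm).
by simpc.
Qed.

End ChangeOfVariables.

(** * The Fourier transform as an isometry *)

Section AlmostEverywhere.
Context {R : realType} {d : measure_display} {T : measurableType d}.
Variable mu : {measure set T -> \bar R}.

Lemma ae_mp (P Q : T -> Prop) : (forall x, P x -> Q x) ->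
  {ae mu, forall x, P x} -> {ae mu, forall x, Q x}.
Proof. by move=> PQ; apply: filterS. Qed.

Lemma ae_mp2 (P Q S : T -> Prop) : (forall x, P x -> Q x -> S x) ->
  {ae mu, forall x, P x} -> {ae mu, forall x, Q x} -> {ae mu, forall x, S x}.
Proof. by move=> PQS HP HQ; apply: filterS2 HP HQ. Qed.

Lemma ae_and (P Q : T -> Prop) : {ae mu, forall x, P x} ->
  {ae mu, forall x, Q x} -> {ae mu, forall x, P x /\ Q x}.
Proof. by apply: ae_mp2. Qed.

Lemma ae_forall_fin (I : finType) (P : I -> T -> Prop) :
  (forall i, {ae mu, forall x, P i x}) -> {ae mu, forall x, forall i, P i x}.
Proof. by move=> H; exact: filter_forall. Qed.

End AlmostEverywhere.

Section FourierIsometry.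
Variables (R : realType) (G : topologicalZmodType).
Variables (mu : {measure set (borel G) -> \bar R}).
Variables (nu : {measure set (borel (dual R G)) -> \bar R}).
Variable F : (G -> R[i]) -> (dual R G -> R[i]).
Hypothesis FU : fourier_extends_unitarily mu nu F.

Let FL2 f : L2 mu setT f -> L2 nu setT (F f). Proof. by case: FU => + _ _ _ _; exact. Qed.

Lemma fourier_sqnorm f : L2 mu setT f -> sqnorm nu setT (F f) = sqnorm mu setT f.
Proof.
move=> fL; have FfL := FL2 fL; case: FU => _ _ /(_ f f fL fL) + _ _.
rewrite !inner_self // => -[].
have fin : sqnorm mu setT f \is a fin_num by rewrite ge0_fin_numE ?sqnorm_ge0 // fL.2.
have Ffin : sqnorm nu setT (F f) \is a fin_num by rewrite ge0_fin_numE ?sqnorm_ge0 // FfL.2.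
by move=> e; rewrite -(fineK fin) -(fineK Ffin) e.
Qed.

Lemma fourier0 : {ae nu, forall xi, F (fun=> 0) xi = 0}.
Proof.
have L0 : L2 mu setT (fun=> 0 : R[i]) by exact: L2_cst0.
have := sqnorm_eq0_ae (mu := nu) measurableT (FL2 L0).1.
rewrite fourier_sqnorm // sqnormE integral0_eq; last by move=> x _; rewrite sqmod0.
by move=> /(_ erefl); apply: ae_mp => xi; exact.
Qed.

Lemma fourierZ (c : R[i]) f : L2 mu setT f ->
  {ae nu, forall xi, F (fun x => c * f x) xi = c * F f xi}.
Proof.
move=> fL; have L0 : L2 mu setT (fun=> 0 : R[i]) by exact: L2_cst0.
case: FU => _ /(_ c f _ fL L0) + _ _ _.
rewrite (_ : (fun x => c * f x + 0) = (fun x => c * f x)); last first.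
  by apply/funext => x; rewrite addr0.
by move=> H; apply: ae_mp2 H fourier0 => xi -> ->; rewrite addr0.
Qed.

Lemma fourierB f g : L2 mu setT f -> L2 mu setT g ->
  {ae nu, forall xi, F (fun x => f x - g x) xi = F f xi - F g xi}.
Proof.
move=> fL gL; case: FU => _ /(_ (-1) g f gL fL) + _ _ _.
rewrite (_ : (fun x => -1 * g x + f x) = (fun x => f x - g x)); last first.
  by apply/funext => x; rewrite mulN1r addrC.
by apply: ae_mp => xi ->; rewrite mulN1r addrC.
Qed.

Lemma fourier_sum (n : nat) (c : 'I_n -> R[i]) (h : 'I_n -> G -> R[i]) :
  (forall k, L2 mu setT (h k)) ->
  {ae nu, forall xi, F (fun x => \sum_(k < n) c k * h k x) xi =
                     \sum_(k < n) c k * F (h k) xi}.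
Proof.
elim: n c h => [|n IH] c h hL.
  have e : (fun x => \sum_(k < 0) c k * h k x) = fun=> 0.
    by apply/funext => x; rewrite big_ord0.
  by apply: ae_mp fourier0 => xi; rewrite e big_ord0.
have e : (fun x => \sum_(k < n.+1) c k * h k x) =
    (fun x => c ord0 * h ord0 x + \sum_(k < n) c (lift ord0 k) * h (lift ord0 k) x).
  by apply/funext => x; rewrite big_ord_recl.
have SL : L2 mu setT (fun x => \sum_(k < n) c (lift ord0 k) * h (lift ord0 k) x).
  by apply: L2_sum => // k; exact: L2Z.
case: FU => _ /(_ (c ord0) (h ord0) _ (hL ord0) SL) + _ _ _.
move=> H; apply: ae_mp2 H (IH (fun k => c (lift ord0 k)) _ (fun k => hL (lift ord0 k))) => xi.
by rewrite e => -> ->; rewrite big_ord_recl.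
Qed.

(** Completeness passes in both directions because F is isometric and onto: the
    distance of F f to a combination of the F (e j) is the distance of f to the
    same combination of the e j. *)
Lemma fourier_orthogonal_basis (I : Type) (J : set I) (e : I -> G -> R[i])
    (e' : I -> dual R G -> R[i]) :
  (forall j, J j -> L2 mu setT (e j)) ->
  (forall j, J j -> cmeasurable_fun setT (e' j : borel (dual R G) -> R[i])) ->
  (forall j, J j -> {ae nu, forall xi, F (e j) xi = e' j xi}) ->
  orthogonal_basis mu setT J e <-> orthogonal_basis nu setT J e'.
Proof.
move=> eL me' Fe.
have e'L j : J j -> L2 nu setT (e' j).
  move=> Jj; apply: L2_ae_eq (FL2 (eL j Jj)) _ => //; first exact: me'.
  by apply: ae_mp (Fe j Jj).
have norm_e j : J j -> sqnorm nu setT (e' j) = sqnorm mu setT (e j).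
  move=> Jj; rewrite -(fourier_sqnorm (eL j Jj)); apply: sqnorm_ae_eq => //.
  - exact: me'.
  - exact: (FL2 (eL j Jj)).1.
  - by apply: ae_mp (Fe j Jj).
have inner_e j k : J j -> J k -> inner nu setT (e' j) (e' k) = inner mu setT (e j) (e k).
  move=> Jj Jk; have [_ _ Fin _ _] := FU; rewrite -(Fin _ _ (eL j Jj) (eL k Jk)).
  apply: inner_ae_eq => //.
  - exact: me'.
  - exact: (FL2 (eL j Jj)).1.
  - exact: me'.
  - exact: (FL2 (eL k Jk)).1.
  - by apply: ae_mp (Fe j Jj).
  - by apply: ae_mp (Fe k Jk).
have dist_e f g (n : nat) (j : 'I_n -> I) (c : 'I_n -> R[i]) :
    L2 mu setT f -> L2 nu setT g -> {ae nu, forall xi, F f xi = g xi} ->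
    (forall k, J (j k)) ->
    sqnorm nu setT (fun xi => g xi - \sum_(k < n) c k * e' (j k) xi) =
    sqnorm mu setT (fun x => f x - \sum_(k < n) c k * e (j k) x).
  move=> fL gL Ffg Jj.
  have SL : L2 mu setT (fun x => \sum_(k < n) c k * e (j k) x).
    by apply: L2_sum => // k; apply: L2Z => //; exact: eL.
  rewrite -fourier_sqnorm; last exact: L2B.
  apply: sqnorm_ae_eq => //.
  - apply: cmeasB; first exact: gL.1.
    by apply: cmeas_sum => k; apply: cmeasM; [exact: cmeas_cst|exact: me'].
  - by apply: (FL2 (L2B _ fL SL)).1.
  - have sum_e : {ae nu, forall xi, \sum_(k < n) c k * F (e (j k)) xi =
                              \sum_(k < n) c k * e' (j k) xi}.
      have H := ae_forall_fin (fun k => Fe _ (Jj k)).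
      by apply: ae_mp H => xi Hk; apply: eq_bigr => k _; rewrite Hk.
    have FS := fourier_sum c (fun k => eL _ (Jj k)).
    apply: ae_mp2 (ae_and Ffg sum_e) (ae_and (fourierB fL SL) FS).
    by move=> xi [-> <-] [-> ->].
split=> -[b1 b2 b3]; split.
- by move=> j Jj; split; [exact: e'L|rewrite norm_e //; case: (b1 j Jj)].
- by move=> j k Jj Jk jk; rewrite inner_e // b2.
- move=> g gL eps eps0; case: FU => _ _ _ /(_ g gL)[f fL Ffg] _.
  have [n [j [c [Jj fe]]]] := b3 f fL eps eps0.
  by exists n, j, c; split => //; rewrite (dist_e f).
- by move=> j Jj; split; [exact: eL|rewrite -norm_e //; case: (b1 j Jj)].
- by move=> j k Jj Jk jk; rewrite -inner_e // b2.
- move=> f fL eps eps0; have [n [j [c [Jj fe]]]] := b3 (F f) (FL2 fL) eps eps0.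
  exists n, j, c; split => //; rewrite -(dist_e f (F f)) //; first exact: FL2.
  exact: aeW.
Qed.

End FourierIsometry.

(** * Automorphisms and Haar measure *)

Lemma aut_inverse (G : preTopologicalZmodType) (a : Aut G) :
  exists b : Aut G, cancel a b /\ cancel b a.
Proof.
have [b [ab ba bC]] := aut_homeo a.
have bD : {morph b : x y / x + y}.
  by move=> x y; apply: (can_inj ab); rewrite autD !ba.
by exists (MkAut bD bC (ex_intro _ (a : G -> G) (And3 ba ab (@aut_continuous _ a)))).
Qed.

Lemma autB (G : preTopologicalZmodType) (a : Aut G) (x y : G) : a (x - y) = a x - a y.
Proof. by apply: (addIr (a y)); rewrite -autD !subrK. Qed.

Lemma topological_zmod_sub_continuous (G : topologicalZmodType) :
  continuous (fun z : G * G => z.1 - z.2).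
Proof. by move=> z; exact: sub_continuous. Qed.

Section HaarScaling.
Variables (R : realType) (G : topologicalZmodType).
Hypothesis G_locally_compact : locally_compact [set: G].
Hypothesis G_second_countable : @second_countable G.

Lemma haar_finite_open (mu : {measure set (borel G) -> \bar R}) : haar mu ->
  exists U : set G, [/\ open U, U !=set0 & (mu U < +oo)%E].
Proof.
move=> [[Kfin _ _] _ _]; have [P P0' [cP clP]] := G_locally_compact (x := 0) I.
have P0 : nbhs 0 P by move: P0'; rewrite withinE => -[Q xQ]; rewrite !setIT => ->.
exists P°; split; first exact: open_interior.
  by exists 0; exact: P0.
have mP : measurable (P : set (borel G)) by exact: borel_closed.
apply: le_lt_trans (Kfin P cP mP); apply: le_measure; rewrite ?inE //.
  by apply: borel_open; exact: open_interior.
exact: interior_subset.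
Qed.

Lemma haar_sigma_finite (mu : {measure set (borel G) -> \bar R}) : haar mu ->
  sigma_finite setT mu.
Proof.
move=> hmu; have [U [oU U0 Uoo]] := haar_finite_open hmu.
apply: (invariant_sigma_finite G_second_countable _ _ oU U0 Uoo).
  exact: topological_zmod_sub_continuous.
exact: haar_invariant.
Qed.

(** Translations preserve Haar measure, so a single factor, that of the
    automorphism, serves for all t. *)
Lemma haar_affine_scales (mu : {measure set (borel G) -> \bar R}) (a : Aut G) :
  haar mu -> exists k : R, forall t, scales mu mu (fun x => a x - t : borel G) k.
Proof.
move=> hmu; have [U [oU U0 Uoo]] := haar_finite_open hmu.
have [b [ab ba]] := aut_inverse a.
have subC := @topological_zmod_sub_continuous G.
have [r r0 Hr] := automorphism_scales (a := b) (b := a) G_second_countable subC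
  (haar_invariant hmu) (let: And3 _ h _ := hmu in h) oU U0 Uoo (autB a)
  (@aut_continuous _ b) (@aut_continuous _ a) ba ab.
have tC (t : G) : continuous (fun x : G => x - t) by exact: continuous_subr.
exists r => t; split => //.
  apply: (@continuous_borel_measurable G G) => x.
  exact: (continuous_comp (@aut_continuous _ a x) (tC t _)).
move=> E mE; rewrite -(haar_invariant hmu t mE).
rewrite -(Hr ((fun x => x - t) @^-1` E)) //.
exact: (@continuous_borel_preimage G G).
Qed.

Lemma adjointB (a : Aut G) (xi eta : dual R G) :
  adjoint a (xi - eta) = adjoint a xi - adjoint a eta.
Proof. by apply: charP => x. Qed.

Lemma adjointK (a b : Aut G) : cancel a b ->
  cancel (adjoint b : dual R G -> dual R G) (adjoint a).
Proof. by move=> ab xi; apply: charP => x /=; rewrite ab. Qed.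

Section DualHaar.
Variable nu : {measure set (borel (dual R G)) -> \bar R}.
Hypothesis nu_haar : haar nu.
Variable W : set (dual R G).
Hypothesis W_measurable : measurable (W : set (borel (dual R G))).
Hypothesis W_finite : (nu W < +oo)%E.
Hypothesis W_nonzero : nu W != 0%E.

(** Outer regularity puts W inside an open set of finite measure. Its translates
    then exhaust the dual, which gives sigma-finiteness and makes the
    proportionality of invariant measures applicable. *)
Lemma dual_haar_finite_open :
  exists U : set (dual R G), [/\ open U, U !=set0 & (nu U < +oo)%E].
Proof.
have [[_ outer _] _ _] := nu_haar.
move: W_finite; rewrite outer // => /ereal_inf_lt[_ [U [oU WU] <-] Uoo].
exists U; split => //; apply/set0P; apply: contra W_nonzero => /eqP U0.
by rewrite (_ : W = set0) ?measure0 //; apply/seteqP; split=> // x /WU; rewrite U0.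
Qed.

Lemma dual_haar_sigma_finite : sigma_finite setT nu.
Proof.
have [U [oU U0 Uoo]] := dual_haar_finite_open.
apply: (invariant_sigma_finite _ _ _ oU U0 Uoo).
- exact: dual_second_countable.
- exact: dual_sub_continuous.
- exact: haar_invariant.
Qed.

Lemma dual_haar_adjoint_scales (a : Aut G) :
  exists k : R, scales nu nu (adjoint a : borel (dual R G) -> borel (dual R G)) k.
Proof.
have [U [oU U0 Uoo]] := dual_haar_finite_open.
have [b [ab ba]] := aut_inverse a.
have [r r0 Hr] := automorphism_scales (a := adjoint b) (b := adjoint a)
  (dual_second_countable R G_locally_compact G_second_countable)
  (@dual_sub_continuous R G) (haar_invariant nu_haar)
  (let: And3 _ h _ := nu_haar in h) oU U0 Uoo (adjointB a)
  (@adjoint_dual_continuous R G b) (@adjoint_dual_continuous R G a)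
  (adjointK ab) (adjointK ba).
exists r; split => //.
by apply: continuous_borel_measurable; exact: adjoint_dual_continuous.
Qed.

End DualHaar.

End HaarScaling.

(** * Fourier transforms of affine substitutions *)

Section FourierCovariance.
Variables (R : realType) (G : topologicalZmodType).
Variables (mu : {measure set (borel G) -> \bar R}).
Variables (nu : {measure set (borel (dual R G)) -> \bar R}).
Variable F : (G -> R[i]) -> (dual R G -> R[i]).
Hypothesis FU : fourier_extends_unitarily mu nu F.
Hypothesis mu_sigma_finite : sigma_finite setT mu.
Variables (a b : Aut G) (t : G) (k s : R).
Hypothesis (ab : cancel a b) (ba : cancel b a).
Hypothesis tau_scales : scales mu mu (fun x => a x - t : borel G) k.
Hypothesis beta_scales :
  scales nu nu (adjoint b : borel (dual R G) -> borel (dual R G)) s.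

Local Notation tau := (fun x : G => a x - t).
Local Notation beta := (adjoint b : dual R G -> dual R G).

Let phase (xi : dual R G) : R[i] := k%:C%C * ((chi t (beta xi))^*)%C.

Lemma char_cmeasurable (xi : dual R G) :
  cmeasurable_fun setT (xi : borel G -> R[i]).
Proof.
have xiC : continuous (xi : G -> R[i]^o) by exact: char_continuous.
split; apply: (@continuous_real_measurable G R) => x.
  exact: (continuous_comp (xiC x) (@Re_continuous R _)).
exact: (continuous_comp (xiC x) (@Im_continuous R _)).
Qed.

Lemma chi_cmeasurable (u : G) :
  cmeasurable_fun setT (@chi R G u : borel (dual R G) -> R[i]).
Proof.
split; apply: (@continuous_real_measurable (dual R G) R) => x.
  exact: (continuous_comp (@chi_continuous R G u x) (@Re_continuous R _)).
exact: (continuous_comp (@chi_continuous R G u x) (@Im_continuous R _)).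
Qed.

Lemma fourier_affine_L1 (f : G -> R[i]) (xi : dual R G) : L1 mu setT f ->
  fourier mu (f \o tau) xi = phase xi * fourier mu f (beta xi).
Proof.
move=> fL; pose c : R[i] := ((chi t (beta xi))^*)%C.
pose h (y : G) : R[i] := f y * ((beta xi y)^*)%C.
have hL : L1 mu setT h.
  apply: L1_mul_unit => //; first by apply: cmeas_conj; exact: char_cmeasurable.
  by move=> x; rewrite normcJ char_norm.
have chL : L1 mu setT (fun y => c * h y).
  have := @L1_mul_unit _ _ _ mu setT h (fun=> c) measurableT (cmeas_cst _ _) _ hL.
  under eq_fun do rewrite mulrC; apply => _.
  by rewrite normcJ char_norm.
rewrite /fourier /phase -mulrA -(cintegralZ c measurableT hL).
rewrite -(cintegral_scales tau_scales chL); apply: eq_cintegral => x _ /=.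
rewrite /c /h /chi mulrCA /=; congr (_ * _).
rewrite -rmorphM -charD; congr (_^*)%C; congr (xi _).
by rewrite -(@autD _ b) subrKC ab.
Qed.

Lemma phase_cmeasurable : cmeasurable_fun setT (phase : borel (dual R G) -> R[i]).
Proof.
apply: cmeasM; first exact: cmeas_cst; apply: cmeas_conj.
by case: beta_scales => mb _ _; apply: (cmeas_comp mb); exact: chi_cmeasurable.
Qed.

Lemma sqmod_phase xi : sqmod (phase xi) = k ^+ 2.
Proof. by rewrite sqmodM sqmod_real sqmod_conj sqmod_unit ?mulr1 ?char_norm. Qed.

(** On integrable functions the identity is a substitution in the Fourier
    integral. Both sides depend boundedly on f in mean square, and truncations of
    f to sets of finite measure are integrable and converge to f. *)
Lemma fourier_affine (f : G -> R[i]) : L2 mu setT f ->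
  {ae nu, forall xi, F (f \o tau) xi = phase xi * F f (beta xi)}.
Proof.
have FL2 g : L2 mu setT g -> L2 nu setT (F g) by case: FU => + _ _ _ _; exact.
pose E g xi := F (g \o tau) xi - phase xi * F g (beta xi).
have tL g : L2 mu setT g -> L2 mu setT (g \o tau) by exact: (L2_scales tau_scales).
have rhs_cmeas g : L2 mu setT g ->
    cmeasurable_fun setT (fun xi : borel (dual R G) => phase xi * F g (beta xi)).
  move=> gL; apply: cmeasM; first exact: phase_cmeasurable.
  by case: beta_scales => mb _ _; exact: (cmeas_comp mb (FL2 _ gL).1).
have E_cmeas g : L2 mu setT g -> cmeasurable_fun setT (E g : borel (dual R G) -> R[i]).
  by move=> gL; apply: cmeasB; [exact: (FL2 _ (tL _ gL)).1|exact: rhs_cmeas].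
have k0 : 0 < k by case: tau_scales.
have s0 : 0 < s by case: beta_scales.
(* The defect E g of the identity satisfies |E g|^2 <= C |g|^2: by unitarity the
   first term of E g has squared norm k |g|^2 and the second k^2 s |g|^2. *)
pose C := 2 * k + 2 * k ^+ 2 * s.
have C0 : 0 < C by rewrite addr_gt0 ?mulr_gt0 // exprn_gt0.
have E_bound g : L2 mu setT g -> (sqnorm nu setT (E g) <= C%:E * sqnorm mu setT g)%E.
  move=> gL.
  have -> : E g = (fun xi => F (g \o tau) xi + - (phase xi * F g (beta xi))) by [].
  have mlhs := (FL2 _ (tL _ gL)).1; have mrhs := cmeasN (rhs_cmeas _ gL).
  apply: (le_trans (sqnormD_le nu measurableT mlhs mrhs)).
  rewrite (fourier_sqnorm FU (tL _ gL)).
  rewrite -(preimage_setT tau) (sqnorm_scales tau_scales measurableT gL.1).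
  rewrite preimage_setT.
  have -> : sqnorm nu setT (fun xi : borel (dual R G) => - (phase xi * F g (beta xi))) =
      ((k ^+ 2)%:E * sqnorm nu setT (F g \o (beta : borel (dual R G) -> borel (dual R G))))%E.
    rewrite !sqnormE -ge0_integralZl_EFin ?sqr_ge0 //.
    - by apply: eq_integral => xi _; rewrite -EFinM sqmodN sqmodM sqmod_phase.
    - by move=> xi _; rewrite lee_fin sqmod_ge0.
    - apply: measurable_sqmod.
      by case: beta_scales => mb _ _; exact: (cmeas_comp mb (FL2 _ gL).1).
  rewrite -(preimage_setT beta) (sqnorm_scales beta_scales measurableT (FL2 _ gL).1).
  rewrite (fourier_sqnorm FU gL) !muleA -!EFinM -ge0_muleDl ?lee_fin ?mulr_ge0 ?sqr_ge0 // ?ltW //.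
have /sigma_finiteP[K [KT ndK Kfin]] := mu_sigma_finite.
move=> fL.
have E0 : sqnorm nu setT (E f) = 0%E.
  apply/eqP; rewrite eq_le sqnorm_ge0 andbT; apply/lee_addgt0Pr => e e0; rewrite add0e.
  have eC0 : 0 < e / C by rewrite divr_gt0.
  have cK : mu (~` \bigcup_n K n) = 0%E by rewrite -KT setCT measure0.
  have [n ne] := sqnorm_tail (fun n => (Kfin n).1) ndK cK fL eC0.
  pose fn x := f x * (\1_(K n) x)%:C%C.
  have fnL2 : L2 mu setT fn.
    by apply: L2_restrict; [exact: (Kfin n).1|apply: L2_subset fL => //; exact: (Kfin n).1].
  have fnL1 : L1 mu setT fn by apply: L1_restrict => //; apply Kfin.
  have tfnL1 : L1 mu setT (fn \o tau) by exact: (L1_scales tau_scales).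
  have [_ _ _ _ Ff] := FU.
  have En : {ae nu, forall xi, E fn xi = 0}.
    have H1 := Ff _ tfnL1 (tL _ fnL2).
    have H2 := scales_ae beta_scales (Ff _ fnL1 fnL2).
    apply: ae_mp2 H1 H2 => xi H1 H2.
    by rewrite /E H1 H2 fourier_affine_L1 // subrr.
  have dL : L2 mu setT (fun x => f x - fn x) by exact: L2B.
  have Ed : {ae nu, forall xi, E f xi = E (fun x => f x - fn x) xi}.
    have H1 := fourierB FU fL fnL2.
    have H2 := scales_ae beta_scales H1.
    have H3 := fourierB FU (tL _ fL) (tL _ fnL2).
    apply: ae_mp2 (ae_and En H2) H3 => xi [H1' H2'] H3'.
    rewrite /E [F (_ \o tau) xi in RHS]H3' H2'.
    by move: H1'; rewrite /E => /eqP; rewrite subr_eq0 => /eqP ->; ring.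
  rewrite (sqnorm_ae_eq measurableT (E_cmeas _ fL) (E_cmeas _ dL)); last first.
    by apply: ae_mp Ed => xi.
  apply: le_trans (E_bound _ dL) _.
  have -> : sqnorm mu setT (fun x => f x - fn x) = sqnorm mu (~` K n) f.
    rewrite -[RHS]sqnorm_restrict; apply: eq_sqnorm => x _.
    by rewrite /fn !indicE in_setC; case: (x \in K n);
      rewrite /= ?rmorph0 ?rmorph1 ?mulr0 ?mulr1 ?subrr ?subr0.
  apply: (@le_trans _ _ (C%:E * (e / C)%:E)%E).
    by apply: lee_wpmul2l; [rewrite lee_fin ltW|exact: ltW].
  by rewrite -EFinM mulrC divfK ?gt_eqF.
have := sqnorm_eq0_ae (mu := nu) measurableT (E_cmeas f fL) E0.
by apply: ae_mp => xi /(_ I) /eqP; rewrite /E subr_eq0 => /eqP.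
Qed.

End FourierCovariance.

(** * Mean-square approximation *)

(** The pointwise content of the tiling identity. *)
Lemma esum_indic_eq1 (R : realType) (I : choiceType) (T : Type) (A : set I)
    (B : I -> set T) (x : T) :
  (\esum_(a in A) (\1_(B a) x : R)%:E = 1)%E <->
  (exists2 a, A a & B a x) /\
  (forall a a', A a -> A a' -> B a x -> B a' x -> a = a').
Proof.
have indic1 a : B a x -> (\1_(B a) x : R)%:E = 1%E.
  by move=> Bax; rewrite indicE mem_set.
have indic0 a : ~ B a x -> (\1_(B a) x : R)%:E = 0%E.
  by move=> Bax; rewrite indicE memNset.
have ge0 a : (0 <= (\1_(B a) x : R)%:E)%E by rewrite lee_fin indicE ler0n.
have peel a : A a -> B a x -> (\esum_(a in A) (\1_(B a) x : R)%:E =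
    1 + \esum_(a in A `\` [set a]) (\1_(B a) x : R)%:E)%E.
  move=> Aa Bax; rewrite (esumID [set a]) // setIC (setIidl (A := [set a])) //.
    by rewrite esum_set1 // indic1.
  by move=> _ ->.
split=> [s1|[[a Aa Bax] uniq]]; last first.
  rewrite (peel a) // esum1 ?adde0 // => a' [Aa' /= a'a]; apply: indic0 => Ba'x.
  by apply: a'a; exact: uniq.
split.
  apply: contrapT => noa; have : (\esum_(a in A) (\1_(B a) x : R)%:E = 0)%E.
    by apply: esum1 => a Aa; apply: indic0 => Bax; apply: noa; exists a.
  by rewrite s1 => /eqP; rewrite onee_eq0.
move=> a a' Aa Aa' Bax Ba'x; apply: contrapT => aa'.
have : (1 <= \esum_(a in A `\` [set a]) (\1_(B a) x : R)%:E)%E.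
  apply: esum_ge; exists [set a'].
    by split => // _ ->; split => // /= e; apply: aa'.
  by rewrite fsbig_set1 indic1.
move: s1; rewrite (peel a) // => s1 h.
have : (1 + 1 <= 1 :> \bar R)%E by rewrite -[leRHS]s1 leeD2l.
by rewrite -EFinD lee_fin; lra.
Qed.

Section Approximation.
Context {R : realType} {d : measure_display} {T : measurableType d}.
Variable mu : {measure set T -> \bar R}.
Variables (I : Type) (J : set I) (e : I -> T -> R[i]).
Hypothesis e_cmeas : forall j, J j -> cmeasurable_fun setT (e j).

(** Membership in the closed linear span of the family, in the form in which
    [orthogonal_basis] expresses completeness. *)
Definition approximable (f : T -> R[i]) : Prop := forall eps : R, 0 < eps ->
  exists (n : nat) (j : 'I_n -> I) (c : 'I_n -> R[i]), (forall k, J (j k)) /\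
    (sqnorm mu setT (fun x => f x - \sum_(k < n) c k * e (j k) x)%R < eps%:E)%E.

Let comb_cmeas n (j : 'I_n -> I) (c : 'I_n -> R[i]) : (forall k, J (j k)) ->
  cmeasurable_fun setT (fun x => \sum_(k < n) c k * e (j k) x).
Proof.
by move=> Jj; apply: cmeas_sum => k; apply: cmeasM; [exact: cmeas_cst|exact: e_cmeas].
Qed.

Lemma approximable0 : approximable (fun=> 0).
Proof.
move=> eps eps0; have j : 'I_0 -> I by case.
exists 0%N, j, (fun=> 0); split; first by case.
rewrite (@eq_sqnorm _ _ _ mu setT _ (fun=> 0)); last by move=> x _; rewrite big_ord0 subrr.
by rewrite sqnormE integral0_eq // => x _; rewrite sqmod0.
Qed.

Lemma approximableD f g : cmeasurable_fun setT f -> cmeasurable_fun setT g ->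
  approximable f -> approximable g -> approximable (fun x => f x + g x).
Proof.
move=> mf mg af ag eps eps0; have e40 : 0 < eps / 4 by rewrite divr_gt0.
have [n1 [j1 [c1 [J1 h1]]]] := af _ e40; have [n2 [j2 [c2 [J2 h2]]]] := ag _ e40.
pose j (k : 'I_(n1 + n2)) := match fintype.split k with inl k1 => j1 k1 | inr k2 => j2 k2 end.
pose c (k : 'I_(n1 + n2)) := match fintype.split k with inl k1 => c1 k1 | inr k2 => c2 k2 end.
exists (n1 + n2)%N, j, c; split; first by move=> k; rewrite /j; case: (fintype.split k).
have ml : cmeasurable_fun setT (fun x => f x - \sum_(k < n1) c1 k * e (j1 k) x).
  by apply: cmeasB => //; exact: comb_cmeas.
have mr : cmeasurable_fun setT (fun x => g x - \sum_(k < n2) c2 k * e (j2 k) x).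
  by apply: cmeasB => //; exact: comb_cmeas.
rewrite (@eq_sqnorm _ _ _ mu setT _ (fun x => (f x - \sum_(k < n1) c1 k * e (j1 k) x) +
    (g x - \sum_(k < n2) c2 k * e (j2 k) x))); last first.
  move=> x _; rewrite big_split_ord /= addrACA -opprD; congr (_ - (_ + _)).
    by apply: eq_bigr => k _; rewrite /c /j (unsplitK (inl k)).
  by apply: eq_bigr => k _; rewrite /c /j (unsplitK (inr k)).
apply: le_lt_trans (sqnormD_le mu measurableT ml mr) _.
have -> : (eps%:E = 2%:E * (eps / 4)%:E + 2%:E * (eps / 4)%:E)%E.
  by rewrite -!EFinM -EFinD; congr EFin; field.
by apply: lteD; rewrite lte_pmul2l.
Qed.

Lemma approximable_sum (n : nat) (f : 'I_n -> T -> R[i]) :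
  (forall k, cmeasurable_fun setT (f k)) -> (forall k, approximable (f k)) ->
  approximable (fun x => \sum_(k < n) f k x).
Proof.
elim: n f => [|n IH] f mf af.
  rewrite (_ : (fun x => _) = fun=> 0); first exact: approximable0.
  by apply/funext => x; rewrite big_ord0.
rewrite (_ : (fun x => _) =
    (fun x => f ord0 x + \sum_(k < n) f (lift ord0 k) x)); last first.
  by apply/funext => x; rewrite big_ord_recl.
apply: approximableD => //; first exact: cmeas_sum.
exact: IH.
Qed.

Lemma approximable_lim f : cmeasurable_fun setT f ->
  (forall eps : R, 0 < eps -> exists g, [/\ cmeasurable_fun setT g, approximable g &
     (sqnorm mu setT (fun x => f x - g x)%R < eps%:E)%E]) ->
  approximable f.
Proof.
move=> mf lim eps eps0; have e40 : 0 < eps / 4 by rewrite divr_gt0.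
have [g [mg ag fg]] := lim _ e40; have [n [j [c [Jj h]]]] := ag _ e40.
exists n, j, c; split => //.
have mr : cmeasurable_fun setT (fun x => g x - \sum_(k < n) c k * e (j k) x).
  by apply: cmeasB => //; exact: comb_cmeas.
rewrite (@eq_sqnorm _ _ _ mu setT _ (fun x => (f x - g x) +
    (g x - \sum_(k < n) c k * e (j k) x))); last by move=> x _; rewrite addrA subrK.
apply: le_lt_trans (sqnormD_le mu measurableT (cmeasB mf mg) mr) _.
have -> : (eps%:E = 2%:E * (eps / 4)%:E + 2%:E * (eps / 4)%:E)%E.
  by rewrite -!EFinM -EFinD; congr EFin; field.
by apply: lteD; rewrite lte_pmul2l.
Qed.

Lemma approximable_ae_eq f g : cmeasurable_fun setT f -> cmeasurable_fun setT g ->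
  {ae mu, forall x, f x = g x} -> approximable f -> approximable g.
Proof.
move=> mf mg fg af; apply: approximable_lim => // eps eps0; exists f; split => //.
rewrite (sqnorm_ae_eq (mu := mu) (g := fun=> 0)) //.
- by rewrite sqnormE integral0_eq // => x _; rewrite sqmod0.
- exact: cmeasB.
- by apply: ae_mp fg => x -> _; rewrite subrr.
Qed.

End Approximation.

Section CountableFamilies.
Context {R : realType} {d : measure_display} {T : measurableType d}.
Variable mu : {measure set T -> \bar R}.

Lemma ae_forall_countable (I : Type) (A : set I) (P : I -> T -> Prop) : countable A ->
  (forall a, A a -> {ae mu, forall x, P a x}) ->
  {ae mu, forall x, forall a, A a -> P a x}.
Proof.
move=> /countable_injP[f finj] HP.
have : forall n, {ae mu, forall x, forall a, A a -> f a = n -> P a x}.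
  move=> n; have [[a Aa fa]|no] := pselect (exists2 a, A a & f a = n); last first.
    by apply: aeW => x a Aa fa; exfalso; apply: no; exists a.
  apply: ae_mp (HP a Aa) => x Px a' Aa' fa'.
  suff -> : a' = a by [].
  by apply: finj; rewrite ?inE // fa fa'.
move=> /ae_foralln; apply: ae_mp => x H a Aa; exact: (H (f a)).
Qed.

Lemma countable_bigcup_measurable (I : Type) (A : set I) (B : I -> set T) : countable A ->
  (forall a, A a -> measurable (B a)) -> measurable (\bigcup_(a in A) B a).
Proof.
move=> /countable_injP[f finj] mB.
rewrite (_ : \bigcup_(a in A) B a =
  \bigcup_n \bigcup_(a in [set a | A a /\ f a = n]) B a); last first.
  apply/seteqP; split=> x; first by move=> [a Aa Ba]; exists (f a) => //; exists a.
  by move=> [n _ [a [Aa _] Ba]]; exists a.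
apply: bigcupT_measurable => n.
have [[a Aa fa]|no] := pselect (exists2 a, A a & f a = n).
  rewrite (_ : [set a | _] = [set a]); first by rewrite bigcup_set1; exact: mB.
  apply/seteqP; split=> a' /=; last by move=> ->.
  by move=> [Aa' fa']; apply: finj; rewrite ?inE // fa fa'.
rewrite (_ : [set a | _] = set0) ?bigcup_set0 //.
by apply/seteqP; split=> // a [Aa fa]; apply: no; exists a.
Qed.

End CountableFamilies.

(** * Systems of functions supported on tiles *)

(** The measure-theoretic core of the theorem. A bijection [beta a] rescales the
    measure; the tile of (i, a) is the preimage of [W i] under it. The functions
    [chi x], of modulus one, are transported to the tile and conjugated, which is
    how characters arrive there from the Fourier transform. *)
Section MultiplicativeTiling.
Context {R : realType} {d : measure_display} {T : measurableType d}.
Variable nu : {measure set T -> \bar R}.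
Variables (X : Type) (AT : choiceType) (m : nat).
Variables (chi : X -> T -> R[i]) (beta gamma : AT -> T -> T).
Variables (s : AT -> R) (kappa : AT -> R[i]).
Variables (W : 'I_m -> set T) (L : 'I_m -> set X) (A : set AT).
Hypothesis chi_cmeas : forall x, cmeasurable_fun setT (chi x).
Hypothesis chi_unit : forall x y, `|chi x y| = 1.
Hypothesis beta_scales : forall a, scales nu nu (beta a) (s a).
Hypothesis gamma_measurable : forall a, measurable_fun setT (gamma a).
Hypothesis betaK : forall a, cancel (beta a) (gamma a).
Hypothesis kappa_neq0 : forall a, kappa a != 0.
Hypothesis W_measurable : forall i, measurable (W i).
Hypothesis W_finite : forall i, (nu (W i) < +oo)%E.
Hypothesis W_nonzero : forall i, nu (W i) != 0%E.
Hypothesis W_disjoint : forall i j, i <> j -> W i `&` W j = set0.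
Hypothesis A_countable : countable A.

Definition tile_system (j : 'I_m * X * AT) : T -> R[i] :=
  let: (i, x, a) := j in
  fun y => kappa a * (((chi x (beta a y))^*)%C * (\1_(W i) (beta a y))%:C%C).

Definition tile_index : set ('I_m * X * AT) := [set j | L j.1.1 j.1.2 /\ A j.2].

Let V i a : set T := beta a @^-1` W i.
Let cut i x (y : T) : R[i] := ((chi x y)^*)%C * (\1_(W i) y)%:C%C.

Let s_gt0 a : 0 < s a. Proof. by case: (beta_scales a). Qed.

Let V_measurable i a : measurable (V i a).
Proof. exact: (scales_preimage_measurable (beta_scales a)). Qed.

Let cut_cmeas i x : cmeasurable_fun setT (cut i x).
Proof. by apply: cmeasM; [apply: cmeas_conj|exact: cmeas_indic]. Qed.

Lemma tile_system_cmeas j : cmeasurable_fun setT (tile_system j).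
Proof.
case: j => [[i x] a]; apply: cmeasM; first exact: cmeas_cst.
have [mb _ _] := beta_scales a.
exact: (cmeas_comp mb (cut_cmeas i x)).
Qed.

Lemma tile_system_notin i x a y : ~ V i a y -> tile_system (i, x, a) y = 0.
Proof. by move=> Vy; rewrite /= indicE memNset //= rmorph0 !mulr0. Qed.

Lemma measure_tile i a : nu (V i a) = ((s a)%:E * nu (W i))%E.
Proof. by case: (beta_scales a) => _ _ ->. Qed.

Lemma measure_tile_lty i a : (nu (V i a) < +oo)%E.
Proof. by rewrite measure_tile lte_mul_pinfty // lee_fin ltW. Qed.

Lemma sqnorm_unit (E : set T) f : measurable E -> (forall y, `|f y| = 1) ->
  sqnorm nu E f = nu E.
Proof.
move=> mE f1; rewrite sqnormE -[RHS]mul1e -integral_cst //.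
by apply: eq_integral => y _; rewrite sqmod_unit.
Qed.

Let chi_L2 i x : L2 nu (W i) (chi x).
Proof.
split; first by apply: cmeas_sub (chi_cmeas x).
by rewrite sqnorm_unit.
Qed.

Let cut_L2 i x : L2 nu setT (cut i x).
Proof.
split=> //; rewrite /cut sqnorm_restrict sqnorm_unit // => y.
by rewrite normcJ.
Qed.

Lemma tile_sqnorm i x a :
  sqnorm nu setT (tile_system (i, x, a)) = ((sqmod (kappa a))%:E * nu (V i a))%E.
Proof.
have mb : measurable_fun setT (beta a) by case: (beta_scales a).
have mc : cmeasurable_fun setT (fun y => ((chi x (beta a y))^*)%C).
  by apply: cmeas_conj; exact: (cmeas_comp mb).
rewrite -(sqnorm_unit (f := fun y => ((chi x (beta a y))^*)%C)) //; last first.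
  by move=> y; rewrite normcJ.
rewrite -sqnormZ //; last exact: cmeas_sub mc.
rewrite -[RHS]sqnorm_restrict; apply: eq_sqnorm => y _ /=.
by rewrite mulrA.
Qed.

Lemma tile_system_L2 j : L2 nu setT (tile_system j).
Proof.
split; first exact: tile_system_cmeas.
case: j => [[i x] a]; rewrite tile_sqnorm lte_mul_pinfty ?measure_tile_lty //.
by rewrite lee_fin sqmod_ge0.
Qed.

Lemma tile_system_neq0 j : sqnorm nu setT (tile_system j) != 0%E.
Proof.
case: j => [[i x] a]; rewrite tile_sqnorm measure_tile !mule_eq0 !negb_or.
by rewrite W_nonzero !eqe sqmod_eq0 kappa_neq0 gt_eqF.
Qed.

(** On one tile the system is the image of the functions chi on W i under a map
    that preserves inner products up to conjugation and a nonzero factor. *)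
Lemma tile_inner_same i x x' a :
  inner nu setT (tile_system (i, x, a)) (tile_system (i, x', a)) =
  (sqmod (kappa a) * s a)%:C%C * ((inner nu (W i) (chi x) (chi x'))^*)%C.
Proof.
have hL := L1_mul_conj measurableT (cut_L2 i x) (cut_L2 i x').
set h := (fun y => _) in hL.
have hbL : L1 nu setT (h \o beta a) by exact: (L1_scales (beta_scales a)).
rewrite /inner (@eq_cintegral _ _ _ nu setT _ (fun y => (sqmod (kappa a))%:C%C * (h \o beta a) y)).
  rewrite cintegralZ // (cintegral_scales (beta_scales a) hL) rmorphM mulrA.
  congr (_ * _); rewrite -cintegral_conj //; last exact: L1_mul_conj.
  rewrite -[RHS]cintegral_restrict; apply: eq_cintegral => y _.
  rewrite /h /cut indicE; case: (y \in W i).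
    by rewrite /= !rmorph1 !mulr1 rmorphM.
  by rewrite /= !rmorph0 !mulr0 mul0r.
move=> y _ /=; rewrite rmorphM -mul_conjE /h /cut /=; ring.
Qed.

Lemma tile_inner_disjoint i i' x x' a a' :
  {ae nu, forall y, ~ (V i a y /\ V i' a' y)} ->
  inner nu setT (tile_system (i, x, a)) (tile_system (i', x', a')) = 0.
Proof.
move=> dV; rewrite /inner (cintegral_ae_eq (mu := nu) (g := fun=> 0)) //.
- exact: cintegral0.
- apply: cmeasM; first exact: tile_system_cmeas.
  by apply: cmeas_conj; exact: tile_system_cmeas.
apply: ae_mp dV => y dV _.
have [Vy|nVy] := pselect (V i a y); last by rewrite tile_system_notin // mul0r.
rewrite [X in _ * (X^*)%C]tile_system_notin ?conjc0 ?mulr0 // => V'y.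
by apply: dV.
Qed.

Let Omega a : set T := beta a @^-1` \bigcup_i W i.

Definition tiles_by : Prop :=
  {ae nu, forall y, (\esum_(a in A) (\1_(Omega a) y : R)%:E = 1)%E}.

Let Omega_V a y : Omega a y -> exists i, V i a y.
Proof. by move=> [i _ Vy]; exists i. Qed.

Let V_Omega i a y : V i a y -> Omega a y.
Proof. by move=> Vy; exists i. Qed.

Let W_inj i i' y : W i y -> W i' y -> i = i'.
Proof.
move=> Wy W'y; apply: contrapT => /W_disjoint WW.
by have : (W i `&` W i') y by []; rewrite WW.
Qed.

Let Omega_measurable a : measurable (Omega a).
Proof.
apply: (scales_preimage_measurable (beta_scales a)).
by apply: fin_bigcup_measurable.
Qed.

Lemma tiles_by_disjoint i i' a a' : tiles_by -> A a -> A a' -> (i, a) <> (i', a') ->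
  {ae nu, forall y, ~ (V i a y /\ V i' a' y)}.
Proof.
move=> tile Aa Aa' ne; apply: ae_mp tile => y /esum_indic_eq1[_ uniq] [Vy V'y].
have aa' : a = a' by apply: uniq => //; [exact: V_Omega Vy|exact: V_Omega V'y].
by apply: ne; rewrite aa' in Vy *; congr (_, _); exact: W_inj Vy V'y.
Qed.

(** A function supported on one tile is transported to W i, approximated there by
    the functions chi, and the approximation is transported back. *)
Let approximable_on_tile i a g :
  orthogonal_basis nu (W i) (L i) chi -> A a -> L2 nu setT g ->
  approximable nu tile_index tile_system (fun y => g y * (\1_(V i a) y)%:C%C).
Proof.
move=> [_ _ complete] Aa gL eps eps0.
have [mb _ _] := beta_scales a.
pose f y := ((g (gamma a y))^*)%C.
have fbE y : f (beta a y) = ((g y)^*)%C by rewrite /f betaK.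
have mf : cmeasurable_fun setT f.
  by apply: cmeas_conj; exact: (cmeas_comp (gamma_measurable a) gL.1).
have fL : L2 nu (W i) f.
  split; first exact: cmeas_sub mf.
  have : (sqnorm nu (V i a) (f \o beta a) < +oo)%E.
    apply: le_lt_trans gL.2.
    rewrite (@eq_sqnorm _ _ _ nu _ _ (fun y => (g y)^*)%C); last by move=> y _ /=.
    have -> : sqnorm nu (V i a) (fun y => (g y)^*)%C = sqnorm nu (V i a) g.
      by rewrite !sqnormE; apply: eq_integral => y _; rewrite sqmod_conj.
    by apply: sqnorm_subset => //; exact: gL.1.
  rewrite (sqnorm_scales (beta_scales a)) //; last exact: cmeas_sub mf.
  by rewrite -lte_pdivlMl // gt0_muley // lte_fin invr_gt0.
have es0 : 0 < eps / s a by rewrite divr_gt0.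
have [n [x [c [Lx fx]]]] := complete f fL _ es0.
exists n, (fun k => (i, x k, a)), (fun k => ((c k)^*)%C / kappa a).
split; first by move=> k; split => //=; exact: Lx.
pose r y := f y - \sum_(k < n) c k * chi (x k) y.
have mr : cmeasurable_fun (W i) r.
  apply: cmeas_sub (cmeasB mf _) => //; apply: cmeas_sum => k.
  by apply: cmeasM => //; exact: cmeas_cst.
rewrite (@eq_sqnorm _ _ _ nu _ _ (fun y => ((r (beta a y))^*)%C * (\1_(V i a) y)%:C%C)).
  rewrite sqnorm_restrict.
  have -> : sqnorm nu (V i a) (fun y => ((r (beta a y))^*)%C) =
      sqnorm nu (V i a) (r \o beta a).
    by rewrite !sqnormE; apply: eq_integral => y _; rewrite sqmod_conj.
  rewrite (sqnorm_scales (beta_scales a)) //.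
  by rewrite -lte_pdivlMl // -EFinM mulrC.
move=> y _; have [Vy|nVy] := pselect (V i a y).
  rewrite indicE mem_set // rmorph1 !mulr1 /r rmorphB /= fbE conjcK rmorph_sum.
  congr (_ - _); apply: eq_bigr => k _.
  by rewrite indicE mem_set // rmorph1 mulr1 rmorphM mulrA divfK.
rewrite indicE memNset // rmorph0 !mulr0 big1 ?subrr // => k _.
by rewrite tile_system_notin // mulr0.
Qed.

(** Tiles cover almost everything exactly once, so a square-integrable function
    is the mean-square limit of its finite sums of restrictions to tiles. *)
Lemma tile_system_complete g :
  (forall i, orthogonal_basis nu (W i) (L i) chi) -> tiles_by -> L2 nu setT g ->
  approximable nu tile_index tile_system g.
Proof.
move=> Wbasis tile gL.
have cmeasT j : tile_index j -> cmeasurable_fun setT (tile_system j).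
  by move=> _; exact: tile_system_cmeas.
have /countable_injP[idx idx_inj] := A_countable.
(* E n is the union of the tiles of the n-th element of A, empty if there is
   none; D n collects the first n of them. *)
pose E n : set T := \bigcup_(a in [set a | A a /\ idx a = n]) Omega a.
have E_single a : A a -> E (idx a) = Omega a.
  move=> Aa; rewrite /E (_ : [set a' | _] = [set a]) ?bigcup_set1 //.
  apply/seteqP; split=> a' /=; last by move=> ->.
  by move=> [Aa' ia]; apply: idx_inj; rewrite ?inE.
have E_cases n : (exists2 a, A a & E n = Omega a) \/ E n = set0.
  have [[a Aa ia]|no] := pselect (exists2 a, A a & idx a = n).
    by left; exists a => //; rewrite -ia E_single.
  right; rewrite /E (_ : [set a' | _] = set0) ?bigcup_set0 //.
  by apply/seteqP; split=> // a [Aa ia]; apply: no; exists a.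
have mE n : measurable (E n) by case: (E_cases n) => [[a _ ->]|->].
pose D n : set T := \big[setU/set0]_(k < n) E k.
have mD n : measurable (D n) by apply: bigsetU_measurable.
have restr_cmeas (B : set T) : measurable B ->
    cmeasurable_fun setT (fun y => g y * (\1_B y)%:C%C).
  move=> mB; apply: cmeas_restrict => //; exact: cmeas_sub gL.1.
have approxE n : approximable nu tile_index tile_system
    (fun y => g y * (\1_(E n) y)%:C%C).
  have [[a Aa ->]|->] := E_cases n; last first.
    rewrite (_ : (fun y => _) = fun=> 0); first exact: approximable0.
    by apply/funext => y; rewrite indic0 rmorph0 mulr0.
  rewrite (_ : (fun y => _) = (fun y => \sum_(i < m) g y * (\1_(V i a) y)%:C%C)).
    apply: approximable_sum => // i; first exact: restr_cmeas.
    exact: approximable_on_tile.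
  apply/funext => y; rewrite -mulr_sumr; congr (_ * _).
  have [Oy|nOy] := pselect (Omega a y).
    have [i Vy] := Omega_V Oy.
    rewrite (bigD1 i) //= big1 ?addr0; first by rewrite !indicE !mem_set.
    move=> i' ne; rewrite indicE memNset // => V'y.
    by move/eqP: ne; apply; exact: W_inj V'y Vy.
  rewrite indicE memNset // big1 // => i _; rewrite indicE memNset // => Vy.
  by apply: nOy; exact: V_Omega Vy.
have D_ae n : {ae nu, forall y, g y * (\1_(D n) y)%:C%C =
    \sum_(k < n) g y * (\1_(E k) y)%:C%C}.
  apply: ae_mp tile => y /esum_indic_eq1[_ uniq].
  elim: n => [|n IH]; first by rewrite /D !big_ord0 indic0 rmorph0 mulr0.
  rewrite big_ord_recr /= -IH -mulrDr -rmorphD; congr (_ * (_)%:C%C).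
  rewrite /D big_ord_recr /= -/(D n) !indicE in_setU.
  have [Ey|nEy] := pselect (E n y); last first.
    by rewrite (memNset nEy) orbF addr0.
  rewrite (mem_set Ey) orbT memNset ?add0r //.
  rewrite /D -bigcup_mkord => -[k /= kn [a' [Aa' ka'] Oa'y]].
  have [a [Aa na] Oay] := Ey.
  by move: kn; rewrite -na -ka' (uniq a a') // ltnn.
have approxD n : approximable nu tile_index tile_system
    (fun y => g y * (\1_(D n) y)%:C%C).
  apply: approximable_ae_eq (approximable_sum _ _ approxE) => //.
  - by apply: cmeas_sum => k; exact: restr_cmeas.
  - exact: restr_cmeas.
  - by apply: ae_mp (D_ae n) => y ->.
  - by move=> k; exact: restr_cmeas.
apply: approximable_lim => //; first exact: gL.1.
move=> eps eps0.
have cD : nu (~` \bigcup_n D n) = 0%E.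
  apply/negligibleP; first by apply: measurableC; exact: bigcupT_measurable.
  apply: negligibleS tile => y /= nDy /esum_indic_eq1[[a Aa Oay] _]; apply: nDy.
  exists (idx a).+1 => //; rewrite /D -bigcup_mkord; exists (idx a) => //=.
  by rewrite E_single.
have ndD : nondecreasing_seq D.
  by move=> n n' nn'; apply/subsetPset; exact: subset_bigsetU.
have [n ne] := sqnorm_tail mD ndD cD gL eps0.
exists (fun y => g y * (\1_(D n) y)%:C%C); split => //; first exact: restr_cmeas.
rewrite -sqnorm_restrict in ne; apply: le_lt_trans ne.
rewrite le_eqVlt; apply/orP; left; apply/eqP; apply: eq_sqnorm => y _.
by rewrite !indicE in_setC; case: (y \in D n);
  rewrite /= ?rmorph0 ?rmorph1 ?mulr0 ?mulr1 ?subrr ?subr0.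
Qed.

Lemma tile_system_basis :
  (forall i, orthogonal_basis nu (W i) (L i) chi) -> tiles_by ->
  orthogonal_basis nu setT tile_index tile_system.
Proof.
move=> Wbasis tile; split.
- by move=> j _; split; [exact: tile_system_L2|exact: tile_system_neq0].
- move=> [[i x] a] [[i' x'] a'] [/= Lx Aa] [/= Lx' Aa'] ne.
  have [[ii' aa']|ia] := pselect ((i, a) = (i', a')); last first.
    by apply: tile_inner_disjoint; exact: tiles_by_disjoint.
  rewrite -ii' -aa' tile_inner_same.
  have [_ orth _] := Wbasis i.
  rewrite orth ?conjc0 ?mulr0 //; first by rewrite ii'.
  by move=> xx'; apply: ne; rewrite ii' aa' xx'.
- by move=> g gL; exact: tile_system_complete.
Qed.

Section Converse.
Variable x0 : X.
Hypothesis chi_x0 : forall y, chi x0 y = 1.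
Hypothesis L_x0 : forall i, L i x0.
Hypothesis basis : orthogonal_basis nu setT tile_index tile_system.

(** Labelled by x0, the system consists of multiples of indicators of tiles;
    orthogonality of two of them means that the tiles meet in a null set. *)
Let tiles_disjoint i i' a a' : A a -> A a' -> (i, a) <> (i', a') ->
  {ae nu, forall y, ~ (V i a y /\ V i' a' y)}.
Proof.
move=> Aa Aa' ne; pose B := V i a `&` V i' a'.
have mB : measurable B by exact: measurableI.
have Boo : (nu B < +oo)%E.
  apply: le_lt_trans (measure_tile_lty i a); apply: le_measure; rewrite ?inE //.
  exact: subIsetl.
pose h y : R[i] := (\1_B y)%:C%C.
have ReB y : complex.Re `|h y| = \1_B y.
  by rewrite /h normc_def /= expr0n addr0 sqrtr_sqr ger0_norm // indicE ler0n.
have hL : L1 nu setT h.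
  split; first exact: cmeas_indic.
  by under eq_integral do rewrite ReB; rewrite integral_indic // setIT.
have [_ /(_ (i, x0, a) (i', x0, a')) orth _] := basis.
have : inner nu setT (tile_system (i, x0, a)) (tile_system (i', x0, a')) =
    kappa a * ((kappa a')^*)%C * cintegral nu setT h.
  rewrite -cintegralZ //; apply: eq_cintegral => y _.
  rewrite /= !chi_x0 conjc1 !mul1r /h /B !indicE in_setI rmorphM /=.
  rewrite -[beta a y \in _]/(y \in V i a) -[beta a' y \in _]/(y \in V i' a').
  case: (y \in V i a); case: (y \in V i' a');
    by rewrite /= ?rmorph0 ?rmorph1 /= ?(conjc0, conjc1, mulr0, mul0r, mulr1).
rewrite orth //; last by move=> e; apply: ne; case: e => -> ->.
move=> /esym/eqP; rewrite !mulf_eq0 (negbTE (kappa_neq0 a)) conjc_eq0 (negbTE (kappa_neq0 a')) /=.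
rewrite /cintegral eq_complex /= => /andP[/eqP + _].
rewrite /Rintegral integral_indic // setIT => B0.
have nB : nu B = 0%E by rewrite -(@fineK _ (nu B)) ?B0 // ge0_fin_numE.
by exists B; split => // y /= /contrapT.
Qed.

Let tiles_disjoint_all : {ae nu, forall y, forall a, A a -> forall a', A a' ->
  forall p : 'I_m * 'I_m, (p.1, a) <> (p.2, a') -> ~ (V p.1 a y /\ V p.2 a' y)}.
Proof.
apply: ae_forall_countable => // a Aa; apply: ae_forall_countable => // a' Aa'.
apply: ae_forall_fin => -[i i'].
have [e|ne] := pselect ((i, a) = (i', a')); first by apply: aeW => y; rewrite /= e.
by apply: ae_mp (tiles_disjoint Aa Aa' ne) => y ? _.
Qed.

(** The indicator of a subset of finite measure of the uncovered set vanishes on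
    every tile, so each combination of the system is at distance at least its norm
    from it. *)
Lemma basis_tiles : sigma_finite setT nu -> tiles_by.
Proof.
move=> [S ST Sfin].
pose N := ~` \bigcup_(a in A) Omega a.
have mN : measurable N by apply/measurableC/countable_bigcup_measurable.
have NS n : nu (N `&` S n) = 0%E.
  have [mS Soo] := Sfin n; pose B := N `&` S n.
  have mB : measurable B by exact: measurableI.
  have Boo : (nu B < +oo)%E.
    by apply: le_lt_trans Soo; apply: le_measure; rewrite ?inE //; exact: subIsetr.
  have BL : L2 nu setT (fun y => (\1_B y)%:C%C) by exact: L2_indic.
  have [_ _ complete] := basis.
  apply/eqP; rewrite eq_le measure_ge0 andbT; apply/lee_addgt0Pr => e e0; rewrite add0e.
  have [k [j [c [Jj /ltW]]]] := complete _ BL e e0; apply: le_trans.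
  have mcomb : cmeasurable_fun setT
      (fun y => (\1_B y)%:C%C - \sum_(k0 < k) c k0 * tile_system (j k0) y).
    apply: cmeasB; first exact: cmeas_indic.
    apply: cmeas_sum => k0; apply: cmeasM; first exact: cmeas_cst.
    exact: tile_system_cmeas.
  apply: le_trans (sqnorm_subset nu mB measurableT _ mcomb) => //.
  rewrite (@eq_sqnorm _ _ _ nu _ _ (fun y => (\1_B y)%:C%C)).
    by rewrite sqnorm_indic // setIid.
  move=> y [Ny _]; rewrite big1 ?subr0 // => k0 _.
  case: (j k0) (Jj k0) => [[i x] a] [/= _ Aa].
  rewrite -[X in _ * X]/(tile_system (i, x, a) y) tile_system_notin ?mulr0 // => Vy.
  by apply: Ny; exists a => //; exact: V_Omega Vy.
have N0 : nu N = 0%E.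
  apply/eqP; rewrite -measure_le0 -[N]setIT ST setI_bigcupr.
  have mNS n : measurable (N `&` S n) by apply: measurableI => //; exact: (Sfin n).1.
  apply: (le_trans (measure_sigma_subadditive nu mNS _ (@subset_refl _ _))).
    exact: bigcupT_measurable.
  by rewrite eseries0 // => n _ _; exact: NS.
have cover : {ae nu, forall y, exists2 a, A a & Omega a y}.
  by exists N; split => // y /= nO [a Aa Oy]; apply: nO; exists a.
apply: ae_mp2 cover tiles_disjoint_all => y [a Aa Oy] disj.
apply/esum_indic_eq1; split; first by exists a.
move=> b b' Ab Ab' /Omega_V[i Vy] /Omega_V[i' V'y]; apply: contrapT => bb'.
by apply: (disj b Ab b' Ab' (i, i')) => //= -[_].
Qed.

(** Transport f to the tile of (i, a) and approximate it by the whole system.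
    Restricted to that tile, the terms belonging to other tiles vanish almost
    everywhere, and what remains is a combination of the functions chi on W i. *)
Lemma basis_spectral i : A !=set0 -> orthogonal_basis nu (W i) (L i) chi.
Proof.
move=> [a Aa]; have [_ orth complete] := basis; split.
- by move=> x Lx; split; [exact: chi_L2|rewrite sqnorm_unit].
- move=> x x' Lx Lx' xx'.
  have : inner nu setT (tile_system (i, x, a)) (tile_system (i, x', a)) = 0.
    by apply: orth => // -[].
  rewrite tile_inner_same => /eqP; rewrite mulf_eq0 conjc_eq0 => /orP[|/eqP //].
  rewrite eq_complex /= eqxx andbT mulf_eq0 sqmod_eq0 (negbTE (kappa_neq0 a)) /=.
  by rewrite gt_eqF.
move=> f fL eps eps0.
have [mb _ _] := beta_scales a.
pose fW y := f y * (\1_(W i) y)%:C%C.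
have fWL : L2 nu setT fW by exact: L2_restrict.
pose g y := ((fW (beta a y))^*)%C.
have gL : L2 nu setT g.
  have [m1 m2] := L2_scales (beta_scales a) fWL.
  split; first exact: cmeas_conj.
  suff -> : sqnorm nu setT g = sqnorm nu setT (fW \o beta a) by [].
  by rewrite !sqnormE; apply: eq_integral => y _; rewrite sqmod_conj.
have se0 : 0 < s a * eps by rewrite mulr_gt0.
have [n [j [c [Jj gc]]]] := complete g gL _ se0.
(* Terms from other tiles get coefficient 0; x0 is a legal label for them. *)
pose on k := ((j k).1.1 == i) && ((j k).2 == a).
pose x k := if on k then (j k).1.2 else x0.
pose c' k := if on k then ((c k * kappa a)^*)%C else 0.
exists n, x, c'; split.
  move=> k; rewrite /x; case: ifP => [/andP[/eqP <- _]|_]; last exact: L_x0.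
  by have [] := Jj k.
pose r y := fW y - \sum_(k < n) c' k * chi (x k) y.
have mr : cmeasurable_fun setT r.
  apply: cmeasB; first exact: fWL.1.
  by apply: cmeas_sum => k; apply: cmeasM; first exact: cmeas_cst.
rewrite (@eq_sqnorm _ _ _ nu _ _ r); last first.
  by move=> y Wy; rewrite /r /fW indicE mem_set // rmorph1 mulr1.
have mdiff : cmeasurable_fun setT
    (fun y => g y - \sum_(k < n) c k * tile_system (j k) y).
  apply: cmeasB; first exact: gL.1.
  apply: cmeas_sum => k; apply: cmeasM; first exact: cmeas_cst.
  exact: tile_system_cmeas.
have mrb : cmeasurable_fun setT (fun y => ((r (beta a y))^*)%C).
  by apply: cmeas_conj; exact: (cmeas_comp mb mr).
suff H : sqnorm nu (V i a) (fun y => ((r (beta a y))^*)%C) =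
    sqnorm nu (V i a) (fun y => g y - \sum_(k < n) c k * tile_system (j k) y).
  have Hr : sqnorm nu (V i a) (r \o beta a) = ((s a)%:E * sqnorm nu (W i) r)%E.
    by rewrite (sqnorm_scales (beta_scales a)) //; exact: cmeas_sub mr.
  have -> : (eps%:E = (s a)^-1%:E * (s a * eps)%:E)%E.
    by rewrite -EFinM mulKf // gt_eqF.
  rewrite lte_pdivlMl // -Hr.
  apply: le_lt_trans gc; apply: (@le_trans _ _ (sqnorm nu (V i a)
      (fun y => g y - \sum_(k < n) c k * tile_system (j k) y))).
    by rewrite -H !sqnormE le_eqVlt; apply/orP; left; apply/eqP/eq_integral => y _;
      rewrite sqmod_conj.
  exact: sqnorm_subset.
(* Terms belonging to other tiles vanish almost everywhere on this one. *)
apply: sqnorm_ae_eq => //.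
- exact: cmeas_sub mrb.
- exact: cmeas_sub mdiff.
apply: ae_mp tiles_disjoint_all => y disj Vy.
rewrite /r rmorphB rmorph_sum; congr (_ - _).
apply: eq_bigr => k _; rewrite rmorphM /c' /x.
case: (boolP (on k)) => [/andP[/eqP ji /eqP ja]|nk].
  move: ji ja; case: (j k) => [[i' x'] a'] /= -> ->.
  by rewrite indicE mem_set // rmorph1 mulr1 conjcK mulrA.
rewrite rmorph0 mul0r.
move: nk (Jj k); rewrite /on; case: (j k) => [[i' x'] a'] /= nk [_ /= Aa'].
rewrite -[X in _ * X]/(tile_system (i', x', a') y) tile_system_notin ?mulr0 // => V'y.
apply: (disj a Aa a' Aa' (i, i')) => //= -[ii' aa'].
by rewrite ii' aa' !eqxx in nk.
Qed.

End Converse.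

End MultiplicativeTiling.

(** * Wavelet collections of sets *)

(** Both the scaling factor and the default value are positive. *)
Lemma Delta_gt0 (R : realType) (G : preTopologicalZmodType)
    (mu : {measure set (borel G) -> \bar R}) (a : Aut G) : 0 < Delta mu a.
Proof.
rewrite /Delta; set P := (X in xget _ X).
have [[r Pr]|noP] := pselect (exists r, P r); first by case: (xgetI 1 Pr).
by rewrite xgetPN // => r Pr; apply: noP; exists r.
Qed.

Theorem theorem2p2 (R : realType) (G : topologicalZmodType)
  (G_hausdorff : hausdorff_space G)
  (G_locally_compact : locally_compact [set: G])
  (G_second_countable : @second_countable G)
  (G_infinite : infinite_set [set: G])
  (G_nondiscrete : ~ discrete G)
  (G_lattice : exists H : zmodClosed G, lattice H)
  (mG : {measure set (borel G) -> \bar R})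
  (mGhat : {measure set (borel (dual R G)) -> \bar R})
  (mG_haar : haar mG)
  (mGhat_haar : haar mGhat)
  (F : (G -> R[i]) -> (dual R G -> R[i]))
  (F_fourier : fourier_extends_unitarily mG mGhat F)
  (Delta_neq1 : exists a : Aut G, Delta mG a != 1)
  (m : nat) (m_gt0 : (0 < m)%N)
  (W : 'I_m -> set (dual R G))
  (W_measurable : forall i, measurable (W i : set (borel (dual R G))))
  (W_finite : forall i, (mGhat (W i) < +oo)%E)
  (W_nonzero : forall i, mGhat (W i) != 0%E)
  (W_disjoint : forall i j, i <> j -> W i `&` W j = set0)
  (A : set (Aut G)) (A_countable : countable A) (A_nonempty : A !=set0)
  (L : 'I_m -> set G)
  (L_countable : forall i, countable (L i))
  (L_nonempty : forall i, L i !=set0) :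
  ((forall i, spectral_pair mGhat (W i) (L i)) ->
   tiles_multiplicatively mGhat (\bigcup_i W i) A ->
   wavelet_collection mG mGhat F W A L)
  /\
  ((forall i, L i 0) ->
   wavelet_collection mG mGhat F W A L ->
   (forall i, spectral_pair mGhat (W i) (L i)) /\
   tiles_multiplicatively mGhat (\bigcup_i W i) A).
Proof.
(* Any of the sets W i witnesses that the dual has open sets of finite measure. *)
pose i0 := Ordinal m_gt0.
have mG_sf := haar_sigma_finite G_locally_compact G_second_countable mG_haar.
have mGhat_sf := dual_haar_sigma_finite G_locally_compact G_second_countable
  mGhat_haar (W_measurable i0) (W_finite i0) (W_nonzero i0).
have [inv invP] := choice (@aut_inverse G).
have [k kP] := choice (fun a => haar_affine_scales G_locally_compact
  G_second_countable a mG_haar).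
have [s sP] := choice (fun a => dual_haar_adjoint_scales G_locally_compact
  G_second_countable mGhat_haar (W_measurable i0) (W_finite i0) (W_nonzero i0) (inv a)).
pose T := borel (dual R G).
pose beta a : T -> T := adjoint (inv a).
pose gamma a : T -> T := adjoint a.
have betaK a : cancel (beta a) (gamma a) by apply: adjointK; case: (invP a).
have gammaK a : cancel (gamma a) (beta a) by apply: adjointK; case: (invP a).
have gamma_meas a : measurable_fun setT (gamma a).
  by apply: continuous_borel_measurable; exact: adjoint_dual_continuous.
have chi_unit (x : G) (xi : T) : `|chi x xi| = 1 by exact: char_norm.
(* The normalizing factor of the wavelets times the Haar scaling factor of a. *)
pose kappa a : R[i] := (Num.sqrt (Delta mG a))%:C%C * (k a)%:C%C.
have kappa0 a : kappa a != 0.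
  have ka0 : 0 < k a by case: (kP a 0).
  by rewrite mulf_neq0 // -(rmorph0 (real_complex R)) (inj_eq (@complexI R))
    gt_eqF // sqrtr_gt0 Delta_gt0.
have tilesE : tiles_multiplicatively mGhat (\bigcup_i W i) A <->
    tiles_by mGhat beta W A.
  suff H a : adjoint a @` (\bigcup_i W i) = beta a @^-1` (\bigcup_i W i).
    rewrite /tiles_multiplicatively /tiles_by.
    split; apply: ae_mp => xi <-; apply: eq_esum => a _; by rewrite -(H a).
  apply/seteqP; split=> xi /=; first by move=> [eta We <-]; rewrite gammaK.
  by move=> Wb; exists (beta a xi) => //; exact: betaK.
have transfer (psi : 'I_m -> G -> R[i]) : (forall i, L2 mG setT (psi i) /\
       {ae mGhat, forall xi, F (psi i) xi = (\1_(W i) xi : R)%:C%C}) ->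
    orthogonal_basis mG setT [set j : 'I_m * G * Aut G | L j.1.1 j.1.2 /\ A j.2]
      (wavelet_system mG psi) <->
    orthogonal_basis mGhat setT (tile_index L A)
      (tile_system (@chi R G : G -> T -> R[i]) beta kappa W).
  move=> psiP; apply: (fourier_orthogonal_basis F_fourier).
  - move=> [[i t] a] _; apply: L2Z => //.
    exact: (L2_scales (kP a t) (psiP i).1).
  - move=> j _; apply: (tile_system_cmeas (nu := mGhat) (s := s)) => //.
    exact: chi_cmeasurable.
  - move=> [[i t] a] _.
    have [psiL Fpsi] := psiP i.
    have [ia ai] := invP a.
    have pL := L2_scales (kP a t) psiL.
    have H1 := fourierZ F_fourier (Num.sqrt (Delta mG a))%:C%C pL.
    have H2 := fourier_affine F_fourier mG_sf ia (kP a t) (sP a) psiL.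
    have H3 := scales_ae (sP a) Fpsi.
    apply: ae_mp2 (ae_and H1 H2) H3 => xi [h1 h2] h3.
    by rewrite /wavelet_system h1 h2 h3 /= /kappa !mulrA.
split=> [spectral /tilesE tile|L0 [psi [psiP /(transfer _ psiP) basis]]].
  have L2W i : L2 mGhat setT (fun xi => (\1_(W i) xi : R)%:C%C).
    exact: L2_indic.
  have [_ _ _ surj _] := F_fourier.
  have psi_ex i : exists f : G -> R[i], L2 mG setT f /\
      {ae mGhat, forall xi, F f xi = (\1_(W i) xi : R)%:C%C}.
    by have [f fL Ff] := surj _ (L2W i); exists f.
  have [psi psiP] := choice psi_ex.
  exists psi; split => //; apply/(transfer _ psiP).
  apply: (tile_system_basis (gamma := gamma) (s := s)) => //.
  - exact: chi_cmeasurable.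
  - by move=> i; have [] := spectral i.
have chi0 (xi : T) : chi 0 xi = 1.
  by apply: (mulfI (char_neq0 xi 0)); rewrite /chi -charD addr0 mulr1.
have chim := @chi_cmeasurable R G.
split; last first.
  apply/tilesE.
  exact: (basis_tiles chim sP kappa0 W_measurable W_finite A_countable chi0 L0 basis mGhat_sf).
move=> i; split => //.
exact: (basis_spectral chim chi_unit sP kappa0 W_measurable W_finite W_nonzero
  A_countable chi0 L0 basis i A_nonempty).
Qed.
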